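(* Let $F$ be an algebraically closed field of characteristic zero, let $G=\langle a\rangle_2\times\langle b\rangle_2\cong\mathbb{Z}_2\oplus\mathbb{Z}_2$, let $\beta:G\times G\to F^*$ be any skew-symmetric bicharacter, and let $B$ be a finite dimensional simple Lie algebra over $F$ with the trivial $G$-grading. Let $L=F[G]\otimes B$, graded by $\deg(g\otimes x)=g$, be a (finite dimensional) $(G,\beta)$-color Lie superalgebra with respect to a product of the form $[g\otimes x,h\otimes y]=\sigma(g,h)\,gh\otimes[x,y]$ ($g,h\in G$, $x,y\in B$) for some function $\sigma:G\times G\to\{1,-1\}$. Then the graded PI-exponent $$\mathrm{PI\text{-}exp}^{gr}(L)=\lim_{n\to\infty}\sqrt[n]{c_n^{gr}(L)}$$ exists and is equal to $|G|\dim B=4\dim B=\dim L$.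
   Context: $\langle a\rangle_2$ denotes a cyclic group of order $2$ generated by $a$; $F[G]$ is the vector space with basis $G$. A skew-symmetric bicharacter is a map $\beta:G\times G\to F^*$ with $\beta(gh,k)=\beta(g,k)\beta(h,k)$, $\beta(g,hk)=\beta(g,h)\beta(g,k)$, $\beta(g,h)\beta(h,g)=1$. A $G$-graded algebra $L=\bigoplus_{g\in G}L_g$ with product $[\cdot,\cdot]$ is a $(G,\beta)$-color Lie superalgebra if for all homogeneous $x,y,z$ one has $[x,y]=-\beta(\deg x,\deg y)[y,x]$ and $[[x,y],z]=[x,[y,z]]-\beta(\deg x,\deg y)[y,[x,z]]$. (For instance, $\sigma\equiv1$ for $\beta\equiv 1$; and $\sigma(a^ib^j,a^kb^l)=(-1)^{jk}$, $i,j,k,l\in\{0,1\}$, for $\beta(a,a)=\beta(b,b)=1,\ \beta(a,b)=-1$.) Graded identities and codimensions: let $Y=\bigsqcup_{g\in G}Y^g$ with every $Y^g$ countably infinite, and let $F\{Y\}$ be the absolutely free (non-associative, non-unital) $F$-algebra on $Y$. A polynomial $f(y_1^{g_1},\ldots,y_n^{g_n})$ with $y_i^{g_i}\in Y^{g_i}$ is a graded identity of $L$ if $f(u_1,\ldots,u_n)=0$ for all $u_1\in L_{g_1},\ldots,u_n\in L_{g_n}$. Enumerate $G=\{g_1,g_2,g_3,g_4\}$. For $k_1,\ldots,k_4\ge0$ with $k_1+\cdots+k_4=n$, let $P_{k_1,k_2,k_3,k_4}$ be the space of polynomials in $F\{Y\}$ multilinear in $n$ distinct fixed variables, of which $k_s$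 belong to $Y^{g_s}$ ($s=1,\ldots,4$), and let $\mathrm{Id}(L)$ here denote the set of graded identities of $L$. Then $$c_n^{gr}(L)=\sum_{k_1+k_2+k_3+k_4=n}\binom{n}{k_1,k_2,k_3,k_4}\dim\frac{P_{k_1,k_2,k_3,k_4}}{P_{k_1,k_2,k_3,k_4}\cap\mathrm{Id}(L)}.$$ *)

(* Defs.v *)
From HB Require Import structures.
From mathcomp Require Import all_boot all_order all_fingroup all_algebra.
From mathcomp Require Import finmap.
From mathcomp Require Import all_classical all_reals all_analysis.
(* Only the structure instances: the notations of monalg clash with those of
   mathcomp-analysis. *)
From mathcomp Require multinomials.monalg.
Import (canonicals) multinomials.monalg.

Set Implicit Arguments.
Unset Strict Implicit.
Unset Printing Implicit Defensive.

Import Order.TTheory GRing.Theory Num.Theory numFieldNormedType.Exports.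
Local Open Scope ring_scope.

Section LieAlgebras.
Variables (F : fieldType) (B : vectType F) (br : B -> B -> B).

Definition is_lie_bracket :=
  [/\ bilinear_for *:%R *:%R br,
      forall x, br x x = 0
    & forall x y z, br x (br y z) + br y (br z x) + br z (br x y) = 0].

(* One-sided is enough: a Lie bracket is skew-symmetric. *)
Definition is_lie_ideal (I : {vspace B}) :=
  forall x y, y \in I -> br x y \in I.

Definition is_simple_lie :=
  [/\ is_lie_bracket,
      exists x y, br x y != 0
    & forall I : {vspace B}, is_lie_ideal I -> I = 0%VS \/ I = fullv].

End LieAlgebras.

Section GradedAlgebras.
Variables (F : fieldType) (G : finGroupType) (L : vectType F).
Variables (mul : L -> L -> L) (gr : G -> {vspace L}).

Definition is_skew_bicharacter (beta : G -> G -> F) :=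
  [/\ forall g h, beta g h != 0,
      forall g h k, beta (g * h)%g k = beta g k * beta h k,
      forall g h k, beta g (h * k)%g = beta g h * beta g k
    & forall g h, beta g h * beta h g = 1].

Definition is_graded_algebra :=
  [/\ bilinear_for *:%R *:%R mul,
      (\sum_(g : G) gr g)%VS = fullv,
      directv (\sum_(g : G) gr g)
    & forall g h x y, x \in gr g -> y \in gr h -> mul x y \in gr (g * h)%g].

Definition is_color_lie_superalgebra (beta : G -> G -> F) :=
  [/\ is_graded_algebra,
      forall g h x y, x \in gr g -> y \in gr h ->
        mul x y = - (beta g h *: mul y x)
    & forall g h k x y z, x \in gr g -> y \in gr h -> z \in gr k ->
        mul (mul x y) z = mul x (mul y z) - beta g h *: mul y (mul x z)].

End GradedAlgebras.

(* Nonassociative, non-unital monomials. *)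
Inductive magma (Y : Type) := Gen of Y | Op of magma Y & magma Y.

Fixpoint magma_encode Y (t : magma Y) : GenTree.tree Y :=
  match t with
  | Gen y => GenTree.Leaf y
  | Op t1 t2 => GenTree.Node 0 [:: magma_encode t1; magma_encode t2]
  end.

Fixpoint magma_decode Y (t : GenTree.tree Y) : option (magma Y) :=
  match t with
  | GenTree.Leaf y => Some (Gen y)
  | GenTree.Node 0 [:: t1; t2] =>
      if (magma_decode t1, magma_decode t2) is (Some u1, Some u2)
      then Some (Op u1 u2) else None
  | _ => None
  end.

Lemma magma_encodeK Y : pcancel (@magma_encode Y) (@magma_decode Y).
Proof. by elim=> //= t1 -> t2 ->. Qed.

HB.instance Definition _ (Y : eqType) :=
  Equality.copy (magma Y) (pcan_type (@magma_encodeK Y)).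
HB.instance Definition _ (Y : choiceType) :=
  Choice.copy (magma Y) (pcan_type (@magma_encodeK Y)).

Fixpoint leaves Y (t : magma Y) : seq Y :=
  match t with Gen y => [:: y] | Op t1 t2 => leaves t1 ++ leaves t2 end.

(* The absolutely free algebra F{Y}: finitely supported linear combinations of
   nonassociative monomials, with the bilinear extension of Op as product. *)
Definition free_alg (F : fieldType) (Y : choiceType) := monalg.malg (magma Y) F.
HB.instance Definition _ (F : fieldType) (Y : choiceType) :=
  GRing.Lmodule.on (free_alg F Y).

Definition free_mul (F : fieldType) (Y : choiceType) (f1 f2 : free_alg F Y) :
    free_alg F Y :=
  \sum_(t1 <- monalg.msupp f1) \sum_(t2 <- monalg.msupp f2)
    monalg.mkmalgU (Op t1 t2) (monalg.mcoeff t1 f1 * monalg.mcoeff t2 f2).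

Section Evaluation.
Variables (F : fieldType) (Y : choiceType) (L : lmodType F).
Variables (mul : L -> L -> L) (u : Y -> L).

Fixpoint eval_mon (t : magma Y) : L :=
  match t with
  | Gen y => u y
  | Op t1 t2 => mul (eval_mon t1) (eval_mon t2)
  end.

Definition eval (f : free_alg F Y) : L :=
  \sum_(t <- monalg.msupp f) monalg.mcoeff t f *: eval_mon t.

Lemma evalEw (d : {fset magma Y}) (f : free_alg F Y) :
  (monalg.msupp f `<=` d)%fset ->
  eval f = \sum_(t <- d) monalg.mcoeff t f *: eval_mon t.
Proof.
move=> sfd; rewrite /eval; apply: big_fset_incl => // t _ /monalg.mcoeff_outdom ->.
by rewrite scale0r.
Qed.

Lemma eval_is_linear : linear eval.
Proof.
move=> a f g.
pose d := (monalg.msupp f `|` monalg.msupp g `|` monalg.msupp (a *: f + g))%fset.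
rewrite !(@evalEw d); try by apply/fsubsetP=> t; rewrite !inE => ->; rewrite ?orbT.
rewrite scaler_sumr -big_split; apply: eq_bigr => t _ /=.
by rewrite monalg.mcoeffD monalg.mcoeffZ scalerDl scalerA.
Qed.

HB.instance Definition _ :=
  GRing.isLinear.Build F (free_alg F Y) L *:%R eval eval_is_linear.

Lemma evalU (t : magma Y) (a : F) :
  eval (monalg.mkmalgU t a) = a *: eval_mon t.
Proof.
rewrite (@evalEw [fset t]%fset) ?monalg.msuppU_le //.
by rewrite big_seq_fset1 monalg.mcoeffUU.
Qed.

Lemma eval_mul (f g : free_alg F Y) : bilinear_for *:%R *:%R mul ->
  eval (free_mul f g) = mul (eval f) (eval g).
Proof.
case=> mull mulr.
have mulDl z : {morph mul^~ z : x y / x + y}.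
  by move=> x y; have := mull z 1 x y; rewrite /= !scale1r.
have mulDr z : {morph mul z : x y / x + y}.
  by move=> x y; have := mulr z 1 x y; rewrite /= !scale1r.
have mul0l z : mul 0 z = 0 by apply: (addIr (mul 0 z)); rewrite -mulDl !add0r.
have mul0r z : mul z 0 = 0 by apply: (addIr (mul z 0)); rewrite -mulDr !add0r.
have mulZl z a x : mul (a *: x) z = a *: mul x z.
  by have := mull z a x 0; rewrite /= addr0 mul0l addr0.
have mulZr z a x : mul z (a *: x) = a *: mul z x.
  by have := mulr z a x 0; rewrite /= addr0 mul0r addr0.
rewrite /free_mul linear_sum /= [in RHS]/eval.
rewrite (big_morph (mul^~ _) (mulDl _) (mul0l _)); apply: eq_bigr => t1 _.
rewrite linear_sum (big_morph _ (mulDr _) (mul0r _)); apply: eq_bigr => t2 _ /=.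
by rewrite evalU mulZl mulZr scalerA.
Qed.

End Evaluation.

(* d is the dimension of V / W, as witnessed by a family of d elements of V
   that is a basis of V modulo W. *)
Definition is_quot_dim (F : fieldType) (M : lmodType F) (V W : set M) (d : nat) :=
  exists e : 'I_d -> M,
    [/\ forall i, V (e i),
        forall c : 'I_d -> F, W (\sum_i c i *: e i) -> forall i, c i = 0
      & forall v, V v -> exists c : 'I_d -> F, W (v - \sum_i c i *: e i)].

Definition quot_dim (F : fieldType) (M : lmodType F) (V W : set M) : nat :=
  get [set d | is_quot_dim V W d].

Section GradedCodimensions.
Variables (F : fieldType) (G : finGroupType) (L : vectType F).
Variables (mul : L -> L -> L) (gr : G -> {vspace L}).

(* The variables are Y = G * nat, with Y^g = {g} * nat. *)
Local Notation Y := (G * nat)%type.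

Definition graded_identity : set (free_alg F Y) :=
  [set f | forall u : Y -> L, (forall y, u y \in gr y.1) -> eval mul u f = 0].

Definition gr_vars (k : G -> nat) : seq Y :=
  [seq (g, i) | g <- enum G, i <- iota 0 (k g)].

Definition multilin (k : G -> nat) : set (free_alg F Y) :=
  [set f | forall t, t \in monalg.msupp f -> perm_eq (leaves t) (gr_vars k)].

Definition gr_codim (n : nat) : nat :=
  (\sum_(k : {ffun G -> 'I_n.+1} | \sum_(g : G) k g == n)
     n`! %/ \prod_(g : G) (k g)`!
     * quot_dim (multilin (fun g => k g))
         (multilin (fun g => k g) `&` graded_identity)%classic)%N.

Definition gr_codim_root (R : realType) (n : nat) : R :=
  (gr_codim n)%:R `^ n%:R^-1.

Definition PIexp_gr (R : realType) : R :=
  limn (gr_codim_root R).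

End GradedCodimensions.

Section TwistedGroupAlgebra.
Variables (F : fieldType) (G : finGroupType) (B : vectType F).

(* F[G] \otimes B is the space of functions G -> B: the tensor g \otimes x is
   the function that is x at g and 0 elsewhere. *)
Definition FGtensor := {ffun G -> B}.
HB.instance Definition _ := Vector.on FGtensor.

Definition tens (g : G) (x : B) : FGtensor :=
  [ffun h => if h == g then x else 0].

Lemma tens_is_linear g : linear (tens g).
Proof.
move=> a x y; apply/ffunP=> h; rewrite !ffunE.
by case: (h == g); rewrite ?scaler0 ?addr0.
Qed.

HB.instance Definition _ g :=
  GRing.isLinear.Build F B FGtensor *:%R (tens g) (tens_is_linear g).

Lemma tens_decomp (u : FGtensor) : u = \sum_(g : G) tens g (u g).
Proof.
apply/ffunP=> h; rewrite sum_ffunE (bigD1 h) //= ffunE eqxx big1 ?addr0 // => g.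
by rewrite eq_sym ffunE => /negPf ->.
Qed.

Definition tens_gr (g : G) : {vspace FGtensor} := limg (linfun (tens g)).

Lemma tens_grP g (u : FGtensor) :
  reflect (exists x, u = tens g x) (u \in tens_gr g).
Proof.
apply: (iffP memv_imgP) => [[x _ ->]|[x ->]]; exists x; rewrite ?memvf ?lfunE //.
Qed.

Definition tens_mul (sigma : G -> G -> F) (br : B -> B -> B)
    (u v : FGtensor) : FGtensor :=
  \sum_(g : G) \sum_(h : G) sigma g h *: tens (g * h)%g (br (u g) (v h)).

Lemma tens_mulE sigma br g h x y : bilinear_for *:%R *:%R br ->
  tens_mul sigma br (tens g x) (tens h y)
  = sigma g h *: tens (g * h)%g (br x y).
Proof.
case=> brl brr.
have br0l z : br 0 z = 0.
  by have := brl z 1 0 0; rewrite /= !scale1r addr0 => /(canLR (addrK _)); rewrite subrr.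
have br0r z : br z 0 = 0.
  by have := brr z 1 0 0; rewrite /= !scale1r addr0 => /(canLR (addrK _)); rewrite subrr.
rewrite /tens_mul (bigD1 g) //= [X in _ + X]big1 ?addr0; last first.
  move=> g' /negPf ng; rewrite big1 // => h' _.
  by rewrite ffunE ng br0l linear0 scaler0.
rewrite (bigD1 h) //= big1 ?addr0 ?ffunE ?eqxx // => h' /negPf nh.
by rewrite [X in br _ X]ffunE nh br0r linear0 scaler0.
Qed.

End TwistedGroupAlgebra.

(* Main.v *)
(* Evaluating a monomial on homogeneous tensors g_i (x) x_i only changes the value of the
   same monomial at the x_i by a sign. Hence c_n^gr(L) is |G|^n times the codimension
   c_n(B) of B as an ungraded algebra, and it must be shown that c_n(B) grows like d^n,
   where d = dim B. It is at most d^(n+1).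

   For the lower bound, the words in ad B span End B (Burnside), and therefore some
   multilinear Lie polynomial h that is alternating in d variables z_1, ..., z_d does not
   vanish on B. Since the sum over i of h(..., T z_i, ...) is tr(T) h, taking
   T = ad u ad v shows that kappa(u, v) h is again a Lie polynomial, kappa being the
   Killing form; this can be iterated. The form kappa is nondegenerate: otherwise it
   vanishes, so every ad x is nilpotent by Cartan's argument, and all the words in ad B have
   trace zero, contradicting Burnside. Therefore det(x_1, ..., x_d) det(y_1, ..., y_d) h
   is a Lie polynomial, and so are the products of h with any even number of determinants
   in disjoint sets of variables. Choosing the columns of these determinants according to
   words with d letters gives about d^n linearly independent functions. *)

Require Import Defs.
From HB Require Import structures.
From mathcomp Require Import all_boot all_order all_fingroup all_algebra.
From mathcomp Require Import finmap.
From mathcomp Require Import all_classical all_reals all_analysis.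
From mathcomp Require multinomials.monalg.
Import (canonicals) multinomials.monalg.
From mathcomp Require Import ring lra zify.
Import Order.TTheory GRing.Theory Num.Theory numFieldNormedType.Exports.
Import VectorInternalTheory.
Local Open Scope ring_scope.

Set Implicit Arguments.
Unset Strict Implicit.
Unset Printing Implicit Defensive.

(** * Burnside's theorem *)

(** Traces produce only values of the Killing form, and a determinant appears through the Gram
    determinant of the values kappa(x_i, y_j). This is why determinants come in pairs. The columns
    need care. At basis vectors a determinant vanishes unless its column carries all d letters; if
    the columns lay inside one block, permuting the letters of a column would give other words at
    which the product is nonzero. The columns are therefore staggered: a word is cut into blocks,
    and the i-th letter of a column lies i blocks after its first one. Once d - 1 blocks are frozen,
    a word at which no determinant of another word vanishes equals that word, so the evaluations are
    diagonal. Such columns require balanced words, with every letter equally frequent. A block of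
    2qd letters has at least d^(2qd) / (2q+1)^(d^2) of them; the loss per letter disappears only for
    large q, so the number of blocks grows with q fixed, and q is chosen from the required
    precision. *)

Definition lin_closed (F : fieldType) (V : lmodType F) (P : V -> Prop) :=
  P 0 /\ forall a u v, P u -> P v -> P (a *: u + v).

Section LinClosed.
Variables (F : fieldType) (V : lmodType F) (P : V -> Prop).
Hypothesis linP : lin_closed P.

Lemma lin_closedD u v : P u -> P v -> P (u + v).
Proof. by move=> Pu Pv; rewrite -[u]scale1r; apply: linP.2. Qed.

Lemma lin_closedZ a u : P u -> P (a *: u).
Proof. by move=> Pu; rewrite -[_ *: _]addr0; apply: linP.2 => //; apply: linP.1. Qed.

Lemma lin_closed_sum I (r : seq I) (Q : pred I) (f : I -> V) :
  (forall i, Q i -> P (f i)) -> P (\sum_(i <- r | Q i) f i).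
Proof. by move=> Pf; apply: big_ind => //; [exact: linP.1|exact: lin_closedD]. Qed.

End LinClosed.

(** Take [U] of maximal rank among the matrices whose row space satisfies [P]; one more vector of
    [P] would raise the rank. *)
Lemma lin_closed_submx (F : fieldType) n (P : 'rV[F]_n -> Prop) :
  lin_closed P -> exists U : 'M[F]_n, forall v, (v <= U)%MS <-> P v.
Proof.
move=> linP.
pose Q k := `[< exists2 U : 'M[F]_n, \rank U = k & forall v, (v <= U)%MS -> P v >].
have exQ : exists k, Q k.
  exists 0%N; apply/asboolP; exists 0; first exact: mxrank0.
  by move=> v; rewrite submx0 => /eqP ->; exact: linP.1.
have ubQ k : Q k -> (k <= n)%N.
  by move=> /asboolP[U <- _]; exact: rank_leq_col.
have [k /asboolP[U rU UP] maxk] := ex_maxnP exQ ubQ.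
exists U => v; split; first exact: UP.
move=> Pv; apply: contraT => vU.
have /maxk : Q (\rank (U + v)%MS).
  apply/asboolP; exists (U + v)%MS => // w /sub_addsmxP[[a b] -> /=].
  have /sub_rVP[c ->] : (b *m v <= v)%MS by exact: submxMl.
  by rewrite addrC; apply: linP.2 => //; apply: UP; exact: submxMl.
rewrite leqNgt -rU ltn_neqAle mxrankS ?addsmxSl // andbT negbK eq_sym => /eqP eqr.
have := (geq_leqif (mxrank_leqif_sup (addsmxSl U v))).
by rewrite eqr leqnn addsmx_sub (negPf vU) andbF.
Qed.

Lemma closed_eigenvalue (F : closedFieldType) n (A : 'M[F]_n.+1) :
  exists a, eigenvalue A a.
Proof.
have /closed_rootP[a rAa] : size (char_poly A) != 1%N by rewrite size_char_poly.
by exists a; rewrite eigenvalue_root_char.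
Qed.

Section Burnside.
Variables (F : closedFieldType) (n : nat) (A : 'M[F]_n.+1 -> Prop).
Hypothesis linA : lin_closed A.
Hypothesis mulA : forall a b, A a -> A b -> A (a *m b).
Hypothesis transA : forall v w : 'rV[F]_n.+1, v != 0 -> exists2 a, A a & v *m a = w.

(* If T has minimal rank, at least 2, and y is an eigenvector of S *m T in the row space
   of T with eigenvalue l, then T *m (S *m T) - l *: T has smaller rank. *)
Lemma burnside_rank1 : exists2 T, A T & \rank T = 1%N.
Proof.
pose Q k := `[< exists2 T, A T & T != 0 /\ \rank T = k >].
have exQ : exists k, Q k.
  have nz1 : (delta_mx 0 0 : 'rV[F]_n.+1) != 0.
    by apply/eqP => /matrixP/(_ 0 0); rewrite !mxE eqxx => /eqP; rewrite oner_eq0.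
  have [T AT vT] := transA (delta_mx 0 0) nz1.
  exists (\rank T); apply/asboolP; exists T => //; split => //.
  by apply: contraNneq nz1 => T0; rewrite -vT T0 mulmx0.
have [k /asboolP[T AT [Tn0 rT]] mink] := ex_minnP exQ.
exists T => //; apply/eqP; rewrite eqn_leq andbC lt0n mxrank_eq0 Tn0 /=.
rewrite leqNgt; apply/negP => rT2.
have /rowV0Pn[y1 /submxP[v1 y1E] y1n0] : T != 0 by [].
have [v2 v2T] : exists v2 : 'rV_n.+1, ~~ (v2 *m T <= y1)%MS.
  apply: contrapT => all1; have : (T <= y1)%MS.
    apply/row_subP => i; rewrite rowE; apply: contraT => h; case: all1.
    by exists (delta_mx 0 i).
  by move/mxrankS; rewrite rank_rV y1n0 leqNgt rT2.
have [S AS v1S] := transA v2 y1n0.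
set R := row_base T.
have RST : (R *m S *m T <= R)%MS by rewrite eq_row_base submxMl.
have [C CE] := submxP RST.
have [r' rE] : exists r', \rank T = r'.+1 by exists (\rank T).-1; rewrite prednK // ltnW.
have [l /eigenvalueP[c cC cn0]] : exists a, eigenvalue C a.
  by move: (C); rewrite rE; apply: closed_eigenvalue.
pose y := c *m R.
have yn0 : y != 0 by rewrite mulmx_free_eq0 // row_base_free.
have yST : y *m (S *m T) = l *: y.
  by rewrite /y -mulmxA (mulmxA R) CE mulmxA cC scalemxAl.
pose T' := T *m (S *m T) - l *: T.
have /mink : Q (\rank T').
  apply/asboolP; exists T'.
    rewrite /T' -scaleN1r addrC; apply: linA.2; last by rewrite mulmxA; auto.
    exact: lin_closedZ.
  split => //; apply: contraNneq v2T => T'0.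
  have : v1 *m T' = 0 by rewrite T'0 mulmx0.
  rewrite /T' mulmxBr (mulmxA v1 T) -y1E mulmxA v1S -scalemxAr -y1E => /eqP.
  by rewrite subr_eq0 => /eqP ->; rewrite scalemx_sub.
have T'E : T' = T *m (S *m T - l%:M) by rewrite mulmxBr mul_mx_scalar.
have yT : (y <= T :&: kermx (S *m T - l%:M))%MS.
  rewrite sub_capmx /y; apply/andP; split.
    by rewrite (submx_trans (submxMl _ _)) // eq_row_base.
  by apply/sub_kermxP; rewrite mulmxBr yST mul_mx_scalar subrr.
have := mxrank_mul_ker T (S *m T - l%:M); rewrite -T'E.
have : (0 < \rank (T :&: kermx (S *m T - l%:M)))%N.
  by rewrite lt0n mxrank_eq0; apply: contraNneq yn0 => h; rewrite -submx0 -h.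
by rewrite -rT => + <-; case: (\rank (T :&: _)) => // m _; rewrite addnS -ltn_subRL subnn ltn0.
Qed.

(** If [A] were proper, a nonzero [N] would define a linear form vanishing on it. On the elements a
    T b, with T = u w of rank one, this reads (w b) N^T (a u) = 0. Here w b is arbitrary, and then
    so is (w b) N^T a once (w b) N^T is nonzero; hence u = 0. *)
Lemma burnside M : A M.
Proof.
have [T AT rT] := burnside_rank1.
have [u [w [TE]]] : exists (u : 'cV[F]_n.+1) (w : 'rV[F]_n.+1), T = u *m w /\ T != 0.
  have := mulmx_base T; rewrite -mxrank_eq0.
  move: (col_base T) (row_base T); rewrite rT => u w <-.
  by exists u, w; split.
move=> Tn0.
have un0 : u != 0 by apply: contraNneq Tn0 => h; rewrite TE h mul0mx.
have wn0 : w != 0 by apply: contraNneq Tn0 => h; rewrite TE h mulmx0.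
pose P (v : 'rV[F]_(n.+1 * n.+1)) := A (vec_mx v).
have linP : lin_closed P.
  split; first by rewrite /P linear0; exact: linA.1.
  by move=> a x y Px Py; rewrite /P linearP; apply: linA.2.
have [U UP] := lin_closed_submx linP.
apply: contrapT => nAM.
have : ~~ (mxvec M <= U)%MS by apply/negP => /UP; rewrite /P mxvecK.
rewrite submxE => /eqP; set K := cokermx U => MK.
have [j colj] : exists j, col j K != 0.
  apply: contrapT => allj; apply: MK; apply/matrixP => i j.
  have -> : K = 0; last by rewrite mulmx0 !mxE.
  apply/matrixP => i' j'; apply/eqP; rewrite mxE; apply: contraT => h; case: allj.
  exists j'; apply: contraNneq h => /matrixP/(_ i' 0); rewrite !mxE => ->; exact: eqxx.
pose N := vec_mx (col j K)^T.
have Nn0 : N != 0.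
  apply: contraNneq colj => N0; rewrite -[col j K]trmxK -[(col j K)^T]vec_mxK -/N N0.
  by rewrite linear0 linear0.
have ann a b : A a -> A b -> (a *m u)^T *m N *m (w *m b)^T = 0.
  move=> Aa Ab; rewrite -mxvec_dotmul trmxK /N vec_mxK trmxK.
  rewrite colE mulmxA; suff -> : mxvec (a *m u *m (w *m b)) *m K = 0 by rewrite mul0mx.
  apply/eqP; rewrite -submxE; apply/UP; rewrite /P mxvecK.
  by rewrite mulmxA -(mulmxA a) -TE; apply: mulA => //; apply: mulA.
have /rowV0Pn[z0 /submxP[z' z'E] z0n0] : N^T != 0 by rewrite trmx_eq0.
have [b Ab wb] := transA z' wn0.
have {}ann a : A a -> z0 *m (a *m u) = 0.
  move=> Aa; have := ann a b Aa Ab; rewrite wb => /(congr1 trmx).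
  by rewrite !trmx_mul !trmxK mulmxA -z'E trmx0.
apply/negP: un0; rewrite negbK; apply/eqP/matrixP => i i0; rewrite ord1 mxE.
have [a Aa za] := transA (delta_mx 0 i) z0n0.
have := ann a Aa; rewrite mulmxA za -rowE => /matrixP/(_ 0 0).
by rewrite !mxE.
Qed.

End Burnside.

(** * Triangular matrices and integral functionals *)

Lemma is_trig_mxM (R : pzRingType) n (A B : 'M[R]_n) :
  is_trig_mx A -> is_trig_mx B ->
  is_trig_mx (A *m B) /\ forall i, (A *m B) i i = A i i * B i i.
Proof.
move=> /is_trig_mxP tA /is_trig_mxP tB; split.
  apply/is_trig_mxP => i j ij; rewrite mxE big1 // => k _.
  have [ik|ki] := ltnP i k; first by rewrite tA // mul0r.
  by rewrite tB ?mulr0 // (leq_ltn_trans ki).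
move=> i; rewrite mxE (bigD1 i) //= big1 ?addr0 // => k.
rewrite -val_eqE neq_ltn => /orP[ki|ik]; last by rewrite tA // mul0r.
by rewrite tB // mulr0.
Qed.

(** Vectors are rows: an eigenvector of [M] acting on rows serves as first row of the change of
    basis, the conjugate has first row (a, 0, ..., 0), and induction treats the lower right
    block. *)
Lemma trigonalization (F : closedFieldType) n (M : 'M[F]_n) :
  exists P T : 'M[F]_n, [/\ P \in unitmx, P *m M = T *m P & is_trig_mx T].
Proof.
elim: n M => [|n IHn] M.
  exists 1%:M, 0; split; [exact: unitmx1|by apply/matrixP; case|exact: mx0_is_trig].
have [a /eigenvalueP[v vM vn0]] := closed_eigenvalue M.
pose P0 : 'M[F]_(1 + n) := row_ebase v.
have P0u : P0 \in unitmx by exact: row_ebase_unit.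
pose T0 : 'M[F]_(1 + n) := P0 *m M *m invmx P0.
have P0M : P0 *m M = T0 *m P0 by rewrite mulmxKV.
have vE : exists2 c, c != 0 & v = c *: usubmx P0.
  have := mulmx_ebase v; rewrite rank_rV vn0 => vE.
  exists (col_ebase v 0 0).
    by have := col_ebase_unit v; rewrite unitmxE det_mx11 unitfE.
  rewrite -[LHS]vE {1}[col_ebase v]mx11_scalar mul_scalar_mx -scalemxAl.
  congr (_ *: _); rewrite -[row_ebase v]/P0.
  have -> : pid_mx true = row_mx 1%:M 0 :> 'M[F]_(1, 1 + n) by exact: pid_mx_row.
  have := mul_row_col (1%:M : 'M[F]_1) 0 (usubmx P0) (dsubmx P0).
  by rewrite vsubmxK mul1mx mul0mx addr0.
have uT0 : usubmx T0 = row_mx a%:M 0.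
  have [c cn0 vc] := vE.
  rewrite /T0 -!mul_usub_mx; have -> : usubmx P0 *m M = a *: usubmx P0.
    apply: (scalerI cn0); rewrite scalemxAl -vc vM vc !scalerA; congr (_ *: _); ring.
  rewrite -scalemxAl mul_usub_mx mulmxV // scalar_mx_block.
  by rewrite /block_mx col_mxKu scale_row_mx scaler0 scale_scalar_mx mulr1.
have [P1 [T1 [P1u P1M T1t]]] := IHn (drsubmx T0).
pose Q : 'M[F]_(1 + n) := block_mx 1%:M 0 0 P1.
have T0E : T0 = block_mx a%:M 0 (dlsubmx T0) (drsubmx T0).
  by rewrite -[LHS]submxK /ulsubmx /ursubmx uT0 row_mxKl row_mxKr.
have Qu : Q \in unitmx by rewrite unitmxE det_ublock det1 mul1r -unitmxE.
exists (Q *m P0), (block_mx a%:M 0 (P1 *m dlsubmx T0) T1); split.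
- by rewrite unitmx_mul P0u andbT.
- have QT : Q *m T0 = block_mx a%:M 0 (P1 *m dlsubmx T0) T1 *m Q.
    rewrite [in LHS]T0E /Q !mulmx_block !mul0mx !mul1mx !mulmx0 !addr0 !add0r P1M.
    by rewrite !mulmx1.
  apply: etrans (esym (mulmxA Q P0 M)) _; rewrite [P0 *m M]P0M.
  by rewrite mulmxA QT -mulmxA.
- apply/is_trig_mxP => i j ij; rewrite block_mxEh mxE.
  case: splitP => i' i'E; rewrite mxE; case: splitP => j' j'E; rewrite ?mxE //.
  + by move: ij; rewrite i'E j'E [i']ord1 [j']ord1.
  + by move: ij; rewrite i'E j'E [i']ord1.
  + by move/is_trig_mxP: T1t => -> //; move: ij; rewrite i'E j'E ltn_add2l.
Qed.

Lemma mxtrace_horner (F : closedFieldType) n (M : 'M[F]_n.+1) :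
  exists mu : 'I_n.+1 -> F, char_poly M = \prod_i ('X - (mu i)%:P) /\
    forall p, \tr (horner_mx M p) = \sum_i p.[mu i].
Proof.
have [P [T [Pu PM Tt]]] := trigonalization M.
have ME : M = invmx P *m T *m P by rewrite -mulmxA -PM mulKmx.
have TXt k : is_trig_mx (T ^+ k) /\ forall i, (T ^+ k) i i = T i i ^+ k.
  elim: k => [|k [IHt IHd]].
    by split=> [|i]; rewrite expr0 ?scalar_mx_is_trig // mxE eqxx.
  have [tM dM] := is_trig_mxM Tt IHt.
  by rewrite exprS; split => // i; rewrite dM IHd exprS.
have MXE k : M ^+ k = invmx P *m T ^+ k *m P.
  elim: k => [|k IHk]; first by rewrite !expr0 mulmx1 mulVmx.
  rewrite exprSr IHk; transitivity (invmx P *m T ^+ k *m (P *m M)).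
    by rewrite mulmxA.
  by rewrite PM exprSr !mulmxA.
exists (fun i => T i i); split.
  rewrite -char_poly_trig //; rewrite /char_poly.
  have -> : char_poly_mx M = map_mx polyC (invmx P) *m char_poly_mx T *m map_mx polyC P.
    rewrite /char_poly_mx mulmxBr mulmxBl -!map_mxM -ME; congr (_ - _).
    by rewrite mul_mx_scalar -scalemxAl -map_mxM mulVmx // map_mx1 scalemx1.
  rewrite !det_mulmx mulrAC -det_mulmx -map_mxM mulVmx // map_mx1 det1 mul1r //.
move=> p; rewrite -[p in LHS]coefK poly_def !linear_sum /=.
under eq_bigr => k _.
  rewrite linearZ /= linearZ /= rmorphXn /= horner_mx_X MXE -mulmxA mxtrace_mulC.
  rewrite -mulmxA mulmxV // mulmx1 /mxtrace.
  over.
rewrite /= [RHS](eq_bigr _ (fun i _ => horner_coef p _)) exchange_big /=.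
by apply: eq_bigr => k _; rewrite big_distrr; apply: eq_bigr => i _; rewrite (TXt k).2.
Qed.

Lemma horner_mx_char_poly (F : fieldType) n (M : 'M[F]_n.+1) p :
  char_poly M %| p -> horner_mx M p = 0.
Proof. by move=> /divpK <-; rewrite rmorphM /= Cayley_Hamilton mulr0. Qed.

(** Chinese remainder theorem. For large [N], p(M) acts on the generalized eigenspace of each
    eigenvalue a in [s] as the scalar [c a]; Cartan's derivation is built this way. *)
Lemma crt_poly (F : fieldType) (s : seq F) (c : F -> F) (N : nat) :
  exists p : {poly F}, forall a, a \in s -> ('X - a%:P) ^+ N %| p - (c a)%:P.
Proof.
elim: s => [|x s [p pP]]; first by exists 0.
have [xs|xs] := boolP (x \in s).
  by exists p => a; rewrite inE => /predU1P[->|]; apply: pP.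
pose Q := \prod_(a <- s) ('X - a%:P) ^+ N.
have /Bezout_eq1_coprimepP[[u w] /= uw] : coprimep (('X - x%:P) ^+ N) Q.
  rewrite /Q; elim: (s) xs => [|y t IHt]; first by rewrite big_nil coprimep1.
  rewrite inE negb_or => /andP[xy xt]; rewrite big_cons coprimepMr IHt // andbT.
  by rewrite coprimep_expr // coprimep_expl // coprimep_XsubC root_XsubC eq_sym.
exists (p + ((c x)%:P - p) * (w * Q)) => a; rewrite inE => /predU1P[->|as_].
  have -> : w * Q = 1 - u * ('X - x%:P) ^+ N by rewrite -uw addrC addKr.
  have -> : p + ((c x)%:P - p) * (1 - u * ('X - x%:P) ^+ N) - (c x)%:P =
    (p - (c x)%:P) * u * ('X - x%:P) ^+ N by ring.
  exact: dvdp_mull.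
rewrite addrAC dvdp_add ?pP // dvdp_mull // dvdp_mull //.
by rewrite /Q (big_rem a) //= dvdp_mulIl.
Qed.

(* An integer-valued substitute for a Q-linear functional on the span of the mu i
   that does not vanish at mu j. *)
Lemma int_functional (F : fieldType) (I : eqType) (mu : I -> F) (j : I) (s : seq I) :
  [pchar F] =i pred0 -> mu j != 0 -> uniq (j :: s) ->
  exists v : I -> int, v j != 0 /\ forall c : I -> int,
    \sum_(i <- j :: s) (c i)%:~R * mu i = 0 -> \sum_(i <- j :: s) c i * v i = 0.
Proof.
move=> /pcharf0P charF0 muj.
have intr0 (z : int) : z%:~R = 0 :> F -> z = 0.
  case: z => m /eqP; last by rewrite NegzE rmorphN /= oppr_eq0 -pmulrn charF0.
  by rewrite -pmulrn charF0 => /eqP ->.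
elim: s => [_|x s IHs /=].
  exists (fun=> 1); split => // c; rewrite !big_seq1 => /eqP.
  by rewrite mulf_eq0 (negPf muj) orbF => /eqP /intr0 ->.
rewrite inE negb_or -!andbA => /and4P[jx js xs us].
have /IHs[v [vj vP]] : uniq (j :: s) by rewrite /= js us.
have neq_x i : i \in j :: s -> i != x.
  by rewrite inE => /predU1P[->//|]; apply: contraTneq => ->.
have sumx (T : nmodType) (f : I -> T) :
    \sum_(i <- [:: j, x & s]) f i = f x + \sum_(i <- j :: s) f i.
  by rewrite !big_cons addrCA.
(* Either a nonzero multiple of [mu x] is an integral combination of the others, which dictates the
   value at [x] after scaling [v] by [N], or every relation has coefficient 0 at [x]. *)
have [[N [c [N0 cP]]]|noN] := pselect (exists (N : int) (c : I -> int), N != 0 /\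
    N%:~R * mu x = \sum_(i <- j :: s) (c i)%:~R * mu i).
  exists (fun i => if i == x then \sum_(i <- j :: s) c i * v i else N * v i).
  split; first by rewrite (negPf jx) mulf_neq0.
  move=> e; rewrite !sumx eqxx => eP.
  have /vP : \sum_(i <- j :: s) (N * e i + e x * c i)%:~R * mu i = 0.
    under eq_bigr do rewrite rmorphD !rmorphM /= mulrDl -!mulrA.
    rewrite big_split /= -!mulr_sumr -cP; move/(congr1 ( *%R N%:~R)): eP.
    by rewrite mulr0 mulrDr addrC mulrCA.
  apply: etrans; rewrite mulr_sumr -big_split big_seq [RHS]big_seq /=.
  apply: eq_bigr => i /neq_x /negPf ->; ring.
exists (fun i => if i == x then 0 else v i); split; first by rewrite (negPf jx).
move=> e; rewrite !sumx eqxx mulr0 add0r => eP.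
have ex0 : e x = 0.
  apply/eqP; apply: contra_notT noN => ex0; exists (- e x), e.
  split; first by rewrite oppr_eq0.
  by apply/esym/eqP; rewrite -subr_eq0 rmorphN mulNr opprK addrC; exact/eqP.
move: eP; rewrite ex0 mul0r add0r => /vP; apply: etrans.
by rewrite big_seq [RHS]big_seq; apply: eq_bigr => i /neq_x /negPf ->.
Qed.

(** * The Killing form of a simple Lie algebra *)

(** Ideals are predicates here, so that simplicity is an induction principle: an ideal property that
    holds at one nonzero vector holds everywhere. *)
Record simple_bracket (F : fieldType) n (br : 'rV[F]_n.+1 -> 'rV_n.+1 -> 'rV_n.+1) := {
  brl : forall z a x y, br (a *: x + y) z = a *: br x z + br y z;
  brr : forall z a x y, br z (a *: x + y) = a *: br z x + br z y;
  brxx : forall x, br x x = 0;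
  jacobi : forall x y z, br x (br y z) + br y (br z x) + br z (br x y) = 0;
  br_nontriv : exists x y, br x y != 0;
  br_simple : forall P, lin_closed P -> (forall x y, P y -> P (br x y)) ->
    forall v, v != 0 -> P v -> forall w, P w }.

Section Killing.
Variables (F : closedFieldType) (n : nat).
Hypothesis charF0 : [pchar F] =i pred0.
Local Notation V := 'rV[F]_n.+1.
Variables (br : V -> V -> V) (S : simple_bracket br).

Lemma br0l z : br 0 z = 0.
Proof. by have := brl S z 1 0 0; rewrite !scale1r addr0 => /(canLR (addrK _)); rewrite subrr. Qed.

Lemma br0r z : br z 0 = 0.
Proof. by have := brr S z 1 0 0; rewrite !scale1r addr0 => /(canLR (addrK _)); rewrite subrr. Qed.

Lemma brDl x y z : br (x + y) z = br x z + br y z.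
Proof. by have := brl S z 1 x y; rewrite !scale1r. Qed.

Lemma brDr x y z : br z (x + y) = br z x + br z y.
Proof. by have := brr S z 1 x y; rewrite !scale1r. Qed.

Lemma brZl a x z : br (a *: x) z = a *: br x z.
Proof. by have := brl S z a x 0; rewrite br0l !addr0. Qed.

Lemma brZr a x z : br z (a *: x) = a *: br z x.
Proof. by have := brr S z a x 0; rewrite br0r !addr0. Qed.

Lemma br_suml z I (r : seq I) (P : pred I) f :
  br (\sum_(i <- r | P i) f i) z = \sum_(i <- r | P i) br (f i) z.
Proof. by apply: (big_morph (br^~ z)) => [x y|]; rewrite ?brDl ?br0l. Qed.

Lemma br_sumr z I (r : seq I) (P : pred I) f :
  br z (\sum_(i <- r | P i) f i) = \sum_(i <- r | P i) br z (f i).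
Proof. by apply: big_morph => [x y|]; rewrite ?brDr ?br0r. Qed.

Lemma brC x y : br x y = - br y x.
Proof.
apply/eqP; rewrite -addr_eq0; have := brxx S (x + y).
by rewrite brDl !brDr !(brxx S) add0r addr0 => /eqP.
Qed.

Definition ad (x : V) : 'M[F]_n.+1 := \matrix_i br x (delta_mx 0 i).

Lemma mul_ad u x : u *m ad x = br x u.
Proof.
rewrite [u in RHS]row_sum_delta br_sumr mulmx_sum_row.
by apply: eq_bigr => i _; rewrite rowK brZr.
Qed.

Lemma eq_mul_row (A B : 'M[F]_n.+1) : (forall u : V, u *m A = u *m B) -> A = B.
Proof. by move=> AB; apply/row_matrixP => i; rewrite !rowE AB. Qed.

Lemma adP a x y : ad (a *: x + y) = a *: ad x + ad y.
Proof. by apply: eq_mul_row => u; rewrite mulmxDr -scalemxAr !mul_ad (brl S). Qed.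

Lemma ad0 : ad 0 = 0.
Proof. by apply: eq_mul_row => u; rewrite mul_ad br0l mulmx0. Qed.

Lemma adZ a x : ad (a *: x) = a *: ad x.
Proof. by have := adP a x 0; rewrite ad0 !addr0. Qed.

Lemma adD x y : ad (x + y) = ad x + ad y.
Proof. by have := adP 1 x y; rewrite !scale1r. Qed.

(** Matrices act on rows from the right, so the factors come in the opposite of the usual order. *)
Lemma ad_br x y : ad (br x y) = ad y *m ad x - ad x *m ad y.
Proof.
apply: eq_mul_row => u; rewrite mulmxBr !mulmxA !mul_ad.
have := jacobi S x y u; rewrite [br u x]brC [br u (br x y)]brC -scaleN1r brZr scaleN1r.
by move/eqP; rewrite subr_eq0 => /eqP.
Qed.

Lemma ad_eq0 x : (ad x == 0) = (x == 0).
Proof.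
apply/eqP/eqP => [adx0|->]; last exact: ad0.
apply/eqP; apply: contraT => xn0; have [y [z]] := br_nontriv S.
rewrite -mul_ad; suff -> : ad y = 0 by rewrite mulmx0 eqxx.
apply: (br_simple S (P := fun y => ad y = 0)) adx0 y => //.
  by split=> [|a u v Pu Pv]; rewrite ?ad0 // adP Pu Pv scaler0 addr0.
by move=> u v Pv; rewrite ad_br Pv mul0mx mulmx0 subrr.
Qed.

Definition wprod (l : seq V) : 'M[F]_n.+1 := \prod_(x <- l) ad x.

Lemma wprod_cat l1 l2 : wprod (l1 ++ l2) = wprod l1 *m wprod l2.
Proof. exact: big_cat. Qed.

Lemma wprod_cons x l : wprod (x :: l) = ad x *m wprod l.
Proof. exact: big_cons. Qed.

(* Every linear-closed property of the nonempty words in ad B holds everywhere: the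
   span of these words acts irreducibly, hence is the full matrix algebra. *)
Lemma ad_words_span (P : 'M[F]_n.+1 -> Prop) :
  lin_closed P -> (forall l, l != [::] -> P (wprod l)) -> forall M, P M.
Proof.
move=> linP Pl M; pose A (M : 'M[F]_n.+1) := forall P : 'M[F]_n.+1 -> Prop,
  lin_closed P -> (forall l, l != [::] -> P (wprod l)) -> P M.
have linA : lin_closed A.
  split=> [Q linQ _|a u v Au Av Q linQ Ql]; first exact: linQ.1.
  by apply: linQ.2; [exact: Au|exact: Av].
have wA l : l != [::] -> A (wprod l) by move=> ln0 Q _; apply.
have mulA a b : A a -> A b -> A (a *m b).
  move=> Aa Ab; apply: (Aa (fun a => A (a *m b))) => [|l ln0].
    split=> [|c u v Au Av]; first by rewrite mul0mx; exact: linA.1.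
    by rewrite mulmxDl -scalemxAl; apply: linA.2.
  apply: (Ab (fun b => A (wprod l *m b))) => [|l' _].
    split=> [|c u v Au Av]; first by rewrite mulmx0; exact: linA.1.
    by rewrite mulmxDr -scalemxAr; apply: linA.2.
  by rewrite -wprod_cat; apply: wA; case: (l) ln0.
have adA x : A (ad x) by have /wA := isT : [:: x] != [::]; rewrite /wprod big_seq1.
suff: A M by apply.
apply: burnside => // v w vn0.
have [x xv] : exists x, br x v != 0.
  apply: contrapT => all0; move/negP: vn0; apply; rewrite -ad_eq0; apply/eqP.
  apply: eq_mul_row => x; rewrite mulmx0 mul_ad brC; apply/eqP.
  by rewrite oppr_eq0; apply: contraT => xv; case: all0; exists x.
(* The vectors reached from [v] form an ideal, nonzero because [v] is not central. *)
pose Q w := exists2 a, A a & v *m a = w.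
apply: (br_simple S (P := Q)) xv _ w; first split.
- by exists 0; [exact: linA.1|rewrite mulmx0].
- move=> c _ _ [a Aa <-] [b Ab <-]; exists (c *: a + b); first exact: linA.2.
  by rewrite mulmxDr scalemxAr.
- by move=> y _ [a Aa <-]; exists (a *m ad y); [exact: mulA|rewrite mulmxA mul_ad].
- by exists (ad x) => //; rewrite mul_ad.
Qed.

Definition killing x y : F := \tr (ad x *m ad y).

Definition derivation (D : 'M[F]_n.+1) :=
  forall y z, br y z *m D = br (y *m D) z + br y (z *m D).

Lemma ad_derivation D z : derivation D -> ad (z *m D) = ad z *m D - D *m ad z.
Proof.
move=> derD; apply: eq_mul_row => u; rewrite mulmxBr !mulmxA !mul_ad derD.
by rewrite addrK.
Qed.

Lemma derivation_ad x : derivation (ad x).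
Proof.
move=> y z; rewrite !mul_ad; have := congr1 (mulmx z) (ad_br x y).
by rewrite mulmxBr !mulmxA !mul_ad => ->; rewrite subrK.
Qed.

Section KillingZero.
Hypothesis kill0 : forall x y, killing x y = 0.

(** For x = [u, v], the Leibniz rule and cyclicity reduce the trace to kappa(u, v D) = 0. All
    brackets therefore satisfy the claim, which makes its solutions a nonzero ideal. *)
Lemma trace_derivation0 D x : derivation D -> \tr (ad x *m D) = 0.
Proof.
move=> derD; have [y [z yz]] := br_nontriv S.
pose P x := \tr (ad x *m D) = 0; have Pbr u v : P (br u v).
  rewrite /P ad_br mulmxBl raddfB /= -!mulmxA.
  have -> : ad v *m D = ad (v *m D) + D *m ad v by rewrite ad_derivation // subrK.
  rewrite mulmxDr raddfD /= [\tr (ad u *m ad _)]kill0 add0r.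
  have -> : ad v *m (ad u *m D) = (ad v *m ad u) *m D by rewrite mulmxA.
  by rewrite mulmxA [in X in _ - X]mxtrace_mulC mulmxA subrr.
apply: (br_simple S (P := P)) yz (Pbr y z) x => [|u v _]; last exact: Pbr.
split=> [|a u v Pu Pv]; first by rewrite /P ad0 mul0mx raddf0.
by rewrite /P adP mulmxDl -scalemxAl raddfD /= linearZ /= Pu Pv mulr0 addr0.
Qed.

(** D - (a + b) sends [y, z] to [(D - a) y, z] + [y, (D - b) z], and each term has one exponent
    lowered. *)
Lemma br_geigen D a b p q (y z : V) : derivation D ->
  y *m (D - a%:M) ^+ p = 0 -> z *m (D - b%:M) ^+ q = 0 ->
  br y z *m (D - (a + b)%:M) ^+ (p + q) = 0.
Proof.
move=> derD; have [m] := ubnP (p + q); elim: m => // m IHm in p q y z *.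
rewrite ltnS => le_m.
case: p => [|p] in le_m *; first by rewrite mulmx1 => -> _; rewrite br0l mul0mx.
case: q => [|q] in le_m *; first by rewrite mulmx1 => _ ->; rewrite br0r mul0mx.
move=> yp zq.
have yp' : y *m (D - a%:M) *m (D - a%:M) ^+ p = 0 by move: yp; rewrite exprS mulmxA.
have zq' : z *m (D - b%:M) *m (D - b%:M) ^+ q = 0 by move: zq; rewrite exprS mulmxA.
rewrite addSn exprS -[_ * _]/(_ *m _) mulmxA.
have -> : br y z *m (D - (a + b)%:M) =
    br (y *m (D - a%:M)) z + br y (z *m (D - b%:M)).
  rewrite !mulmxBr derD !mul_mx_scalar scalerDl -!scaleN1r brDl brDr !brZl !brZr.
  by rewrite !scaleN1r opprD addrACA.
by rewrite mulmxDl IHm ?add0r // addnS -addSn IHm // addSn -addnS.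
Qed.

(** Primary decomposition as an induction principle: Bezout's identity splits off one eigenvalue
    with its whole multiplicity, which [n.+1] bounds. *)
Lemma span_geigen (M : 'M[F]_n.+1) (mu : 'I_n.+1 -> F) (P : V -> Prop) :
  char_poly M = \prod_i ('X - (mu i)%:P) -> lin_closed P ->
  (forall i y, y *m (M - (mu i)%:M) ^+ n.+1 = 0 -> P y) -> forall y, P y.
Proof.
move=> charM linP geP y.
have hornM p q z : z *m horner_mx M p *m horner_mx M q = z *m horner_mx M (p * q).
  by rewrite -mulmxA rmorphM.
have : y *m horner_mx M (\prod_(a <- codom mu) ('X - a%:P)) = 0.
  by rewrite big_image /= -charM horner_mx_char_poly ?mulmx0.
have : {subset codom mu <= codom mu} by [].
have : (size (codom mu) <= n.+1)%N by rewrite size_codom card_ord.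
move: {1 2 4}(codom mu) => s; have [m] := ubnP (size s).
elim: m => // m IHm in s y *; case: s => [|a s].
  by rewrite big_nil rmorph1 mulmx1 => _ _ _ ->; exact: linP.1.
rewrite ltnS => sm sn smu; set t := seq.filter (predC1 a) (a :: s); set k := count_mem a (a :: s).
have -> : \prod_(b <- a :: s) ('X - b%:P) = ('X - a%:P) ^+ k * \prod_(b <- t) ('X - b%:P).
  rewrite (bigID (pred1 a)) /= big_filter; congr (_ * _).
  rewrite (eq_bigr (fun=> 'X - a%:P)) => [|b /eqP -> //].
  by rewrite big_const_seq iter_mulr_1.
have /Bezout_eq1_coprimepP[[u w] /= uw] : coprimep (('X - a%:P) ^+ k) (\prod_(b <- t) ('X - b%:P)).
  rewrite big_filter; elim: (a :: s) => [|b r IHr]; first by rewrite big_nil coprimep1.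
  rewrite big_cons /=; have [//|ba] := eqVneq b a; rewrite /= coprimepMr IHr andbT.
  by rewrite coprimep_expl // coprimep_XsubC root_XsubC.
move=> yk; rewrite -[y]mulmx1 -[1%:M](rmorph1 (horner_mx M)) -uw.
rewrite rmorphD mulmxDr; apply: lin_closedD => //.
  apply: (IHm t) => //.
  - by rewrite /t /= eqxx /= (leq_trans _ sm) // ltnS size_filter count_size.
  - by rewrite (leq_trans _ sn) // size_filter count_size.
  - by move=> b; rewrite mem_filter => /andP[_ /smu].
  - by rewrite hornM -mulrA mulrC -hornM yk mul0mx.
have /codomP[i ai] : a \in codom mu by apply: smu; rewrite inE eqxx.
apply: (geP i); rewrite -ai.
have -> : (M - a%:M) ^+ n.+1 = horner_mx M (('X - a%:P) ^+ n.+1).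
  by rewrite rmorphXn rmorphB /= horner_mx_X horner_mx_C.
have kn : (k <= n.+1)%N by rewrite (leq_trans (count_size _ _)).
rewrite hornM; have -> : w * \prod_(b <- t) ('X - b%:P) * ('X - a%:P) ^+ n.+1 =
    ('X - a%:P) ^+ k * \prod_(b <- t) ('X - b%:P) * (w * ('X - a%:P) ^+ (n.+1 - k)).
  by rewrite -[in LHS](subnKC kn) exprD; move: (_ ^+ k) (_ ^+ (_ - k)) => *; ring.
by rewrite -hornM yk mul0mx.
Qed.

(* Let mu be the eigenvalues of ad x and v an integral vector orthogonal to all integral
   relations between them. The operator D acting as v j on the generalized eigenspace of
   mu j is a derivation, so 0 = tr (ad x D) = \sum_j v j * mu j. This is itself an
   integral relation, hence \sum_j v j ^+ 2 = 0. *)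
Lemma killing0_nilpotent x k : \tr (ad x ^+ k.+1) = 0.
Proof.
have [mu [charM trM]] := mxtrace_horner (ad x); set M := ad x in charM trM *.
suff mu0 i : mu i = 0.
  have := trM ('X ^+ k.+1); rewrite rmorphXn /= horner_mx_X => ->.
  by apply: big1 => i _; rewrite mu0 hornerXn expr0n.
apply/eqP; apply: contraT => mui; have derM : derivation M by exact: derivation_ad.
have permI : perm_eq (index_enum 'I_n.+1) (i :: rem i (index_enum 'I_n.+1)).
  by rewrite perm_to_rem // mem_index_enum.
have /(int_functional charF0 mui)[v [vi vP]] : uniq (i :: rem i (index_enum 'I_n.+1)).
  by rewrite -(perm_uniq permI) index_enum_uniq.
have {}vP (c : 'I_n.+1 -> int) : \sum_j (c j)%:~R * mu j = 0 -> \sum_j c j * v j = 0.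
  by rewrite !(perm_big _ permI); apply: vP.
have sum_delta (R : pzRingType) (f : 'I_n.+1 -> R) j : \sum_l (l == j)%:R * f l = f j.
  by rewrite (bigD1 j) //= eqxx mul1r big1 ?addr0 // => l /negPf ->; rewrite mul0r.
(* Additive coincidences of eigenvalues are integral relations, so [v] respects them; the Leibniz
   rule for [D] rests on this. *)
have vD j k' l : mu j + mu k' = mu l -> v j + v k' = v l.
  move=> mujk; have /vP : \sum_m ((m == j)%:R + (m == k')%:R - (m == l)%:R)%:~R * mu m = 0.
    under eq_bigr do rewrite !(rmorphB, rmorphD, rmorph_nat) /= mulrBl mulrDl.
    by rewrite sumrB big_split /= !sum_delta mujk subrr.
  under eq_bigr do rewrite mulrBl mulrDl.
  by rewrite sumrB big_split /= !sum_delta => /eqP; rewrite subr_eq0 => /eqP.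
have vE j l : mu j = mu l -> v j = v l.
  move=> mujl; have /vP : \sum_m ((m == j)%:R - (m == l)%:R)%:~R * mu m = 0.
    under eq_bigr do rewrite !(rmorphB, rmorph_nat) /= mulrBl.
    by rewrite sumrB /= !sum_delta mujl subrr.
  under eq_bigr do rewrite mulrBl.
  by rewrite sumrB /= !sum_delta => /eqP; rewrite subr_eq0 => /eqP.
pose c a : F := if [pick j | mu j == a] is Some j then (v j)%:~R else 0.
have cE j : c (mu j) = (v j)%:~R.
  rewrite /c; case: pickP => [l /eqP /vE -> //|/(_ j)]; by rewrite eqxx.
(* In [br_geigen] the exponents add up: a bracket of two generalized eigenvectors needs twice
   [n.+1]. *)
pose N := (n.+1 + n.+1)%N.
have [p pP] := crt_poly (codom mu) c N.
have {}pP j : ('X - (mu j)%:P) ^+ N %| p - ((v j)%:~R)%:P by rewrite -cE pP ?codom_f.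
pose D := horner_mx M p.
have hornMX a m : horner_mx M (('X - a%:P) ^+ m) = (M - a%:M) ^+ m.
  by rewrite rmorphXn rmorphB /= horner_mx_X horner_mx_C.
have actD j (y : V) : y *m (M - (mu j)%:M) ^+ N = 0 -> y *m D = (v j)%:~R *: y.
  move=> yj; apply/eqP; rewrite -subr_eq0 -mul_mx_scalar -mulmxBr -(horner_mx_C M) -rmorphB.
  by case/dvdpP: (pP j) => q ->; rewrite mulrC rmorphM /= hornMX -[_ * _]/(_ *m _) mulmxA yj mul0mx.
(* For brackets whose would-be eigenvalue mu j + mu l is not in the spectrum: they vanish. *)
have act0 b (y : V) : (forall j, mu j != b) -> y *m (M - b%:M) ^+ N = 0 -> y = 0.
  move=> mub yb.
  have /Bezout_eq1_coprimepP[[u w] /= uw] : coprimep (('X - b%:P) ^+ N) (char_poly M).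
    rewrite coprimep_expl // coprimep_sym coprimep_XsubC charM; apply/negP.
    rewrite /root horner_prod prodf_seq_eq0 => /hasP[j _ /=].
    by rewrite hornerXsubC subr_eq0 eq_sym (negPf (mub j)).
  rewrite -[y]mulmx1 -[1%:M](rmorph1 (horner_mx M)) -uw [u * _]mulrC rmorphD /=.
  rewrite [X in _ + X]horner_mx_char_poly ?dvdp_mull // addr0 rmorphM /= hornMX.
  by rewrite -[_ * _]/(_ *m _) mulmxA yb mul0mx.
have derD : derivation D.
  pose P y := forall z, br y z *m D = br (y *m D) z + br y (z *m D).
  suff PV y : P y by move=> y z; exact: PV.
  apply: (span_geigen charM) y => [|j y yj z].
    split=> [z|a u w Pu Pw z]; first by rewrite !(br0l, mul0mx) addr0.
    rewrite mulmxDl !brDl mulmxDl -!scalemxAl !brZl -scalemxAl Pu Pw.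
    by rewrite scalerDr addrACA.
  pose Q z := br y z *m D = br (y *m D) z + br y (z *m D).
  apply: (span_geigen charM (P := Q)) z => [|l z zl].
    split=> [|a u w Qu Qw]; first by rewrite /Q !(br0r, mul0mx) addr0.
    rewrite /Q mulmxDl !brDr mulmxDl -!scalemxAl !brZr -scalemxAl Qu Qw.
    by rewrite scalerDr addrACA.
  have weak m (u : V) : u *m (M - (mu m)%:M) ^+ n.+1 = 0 -> u *m D = (v m)%:~R *: u.
    by move=> um; apply: actD; rewrite exprD -[_ * _]/(_ *m _) mulmxA um mul0mx.
  rewrite /Q (weak _ _ yj) (weak _ _ zl) brZl brZr -scalerDl -intrD.
  have yzP := br_geigen derM yj zl.
  have [[m mujl]|nomu] := pselect (exists m, mu j + mu l = mu m).
    by rewrite (vD _ _ _ mujl); apply: actD; rewrite -mujl.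
  rewrite (act0 _ _ _ yzP) ?mul0mx ?scaler0 // => m.
  by apply: contra_notN nomu => /eqP mum; exists m.
have := trace_derivation0 x derD.
have -> : ad x *m D = horner_mx M ('X * p) by rewrite rmorphM /= horner_mx_X.
rewrite trM; under eq_bigr => l _.
  have -> : ('X * p).[mu l] = (v l)%:~R * mu l.
    rewrite hornerM hornerX mulrC; congr (_ * _); apply/eqP.
    rewrite -subr_eq0 -[X in _ - X](hornerC _ (mu l)) -hornerN -hornerD.
    case/dvdpP: (pP l) => q ->; rewrite hornerM horner_exp hornerXsubC subrr.
    by rewrite expr0n mulr0.
  over.
move/vP/eqP; rewrite psumr_eq0 => [|j _]; last by rewrite -expr2 sqr_ge0.
by move/allP/(_ i (mem_index_enum i)); rewrite /= mulf_eq0 orbb (negPf vi).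
Qed.

(* The coefficient of c in \tr ((ad y + c *: ad z) ^+ m *m W). *)
Fixpoint diff_trace y z m (W : 'M[F]_n.+1) : F :=
  if m is m'.+1 then diff_trace y z m' (ad y *m W) + \tr (ad y ^+ m' *m (ad z *m W))
  else 0.

Lemma mxexprSr (R : pzRingType) m (A : 'M[R]_m) k : A ^+ k.+1 = A ^+ k *m A.
Proof. exact: exprSr. Qed.

Lemma diff_traceP y z m W : exists rho : {poly F}, forall c,
  \tr (ad (y + c *: z) ^+ m *m W) =
    \tr (ad y ^+ m *m W) + c * diff_trace y z m W + c ^+ 2 * rho.[c].
Proof.
elim: m W => [|m IHm] W /=.
  by exists 0 => c; rewrite !expr0 horner0 !mulr0 !addr0.
have [r1 r1P] := IHm (ad y *m W); have [r2 r2P] := IHm (ad z *m W).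
exists (r1 + (diff_trace y z m (ad z *m W))%:P + 'X * r2) => c.
rewrite mxexprSr -mulmxA [X in _ *m (X *m W)]adD adZ mulmxDl -scalemxAl mulmxDr.
rewrite -scalemxAr raddfD /= linearZ /= r1P r2P mxexprSr -mulmxA.
rewrite !hornerE; set a := \tr _; set b := \tr _.
set d := diff_trace _ _ _ _; set e := diff_trace _ _ _ _; ring.
Qed.

(** With s the coefficient in question, c s + c^2 rho(c) = 0 for all c. Hence s + X rho vanishes at
    1, 2, 3, ..., which are distinct and nonzero in characteristic zero; so it is the zero
    polynomial, and s is its value at 0. *)
Lemma diff_trace0 y z m W :
  (forall x, \tr (ad x ^+ m *m W) = 0) -> diff_trace y z m W = 0.
Proof.
move=> tr0; have [rho rhoP] := diff_traceP y z m W; set s := diff_trace _ _ _ _ in rhoP *.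
pose q := s%:P + 'X * rho.
have qc c : c != 0 -> q.[c] = 0.
  move=> cn0; apply: (mulfI cn0); rewrite !hornerE mulrDr mulrA -expr2.
  by have := rhoP c; rewrite !tr0 add0r => <-.
suff q0 : q = 0 by have := congr1 (horner^~ 0) q0; rewrite !hornerE.
apply/eqP; apply: contraT => qn0.
have /pcharf0P natr0 := charF0.
have : uniq [seq i.+1%:R : F | i <- iota 0 (size q)].
  rewrite map_inj_uniq ?iota_uniq //.
  suff inj (i j : nat) : (i <= j)%N -> i.+1%:R = j.+1%:R :> F -> i = j.
    by move=> i j; case: (leqP i j) => [/inj //|/ltnW /inj h /esym /h].
  move=> ij /eqP; rewrite eq_sym -subr_eq0 -natrB // natr0 subSS subn_eq0 => ji.
  by apply/eqP; rewrite eqn_leq ij.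
move/(max_poly_roots qn0); rewrite size_map size_iota ltnn => -> //.
by apply/allP => _ /mapP[i _ ->]; rewrite /root qc // natr0.
Qed.

(* Exchanging neighbours changes the trace of a word by the trace of a shorter word, so
   by induction this trace is symmetric in the letters; polarizing the identity
   \tr (ad x ^+ k.+1) = 0 then shows that it vanishes. *)
Lemma trace_word0 k l : size l = k.+1 -> \tr (wprod l) = 0.
Proof.
have [m] := ubnP k; elim: m => // m IHm in k l *; rewrite ltnS => km.
have swap l1 x y l2 : (size l1 + size l2).+1 = k ->
    \tr (wprod (l1 ++ [:: x, y & l2])) = \tr (wprod (l1 ++ [:: y, x & l2])).
  move=> sz; apply/eqP; rewrite -subr_eq0 !wprod_cat !wprod_cons -raddfB -mulmxBr.
  rewrite !mulmxA -mulmxBl -ad_br -wprod_cons -wprod_cat /=.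
  by rewrite (IHm (size l1 + size l2)%N) ?eqxx // ?size_cat /= ?addnS // (leq_trans _ km) // -sz.
(* By [swap] the position of [z] does not matter, so the [i] terms of the derivative are equal; for
   [i] = 0 both sides are 0. *)
have diffE y z i l' : (i + size l' = k.+1)%N ->
    diff_trace y z i (wprod l') = i%:R * \tr (wprod (nseq i.-1 y ++ z :: l')).
  elim: i l' => [|i IHi] l' sz /=; first by rewrite mul0r.
  rewrite -!wprod_cons IHi /= ?addnS //.
  have -> : ad y ^+ i = wprod (nseq i y).
    by rewrite /wprod big_nseq -Monoid.iteropE.
  rewrite -[_ *m wprod _]wprod_cat -[i.+1%:R]natr1 mulrDl mul1r; congr (_ + _).
  case: i sz {IHi} => [|i] sz; first by rewrite !mul0r.
  rewrite /= swap ?size_nseq; last by move: sz; rewrite !addSn => -[].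
  by congr (_ * \tr (wprod _)); elim: (i) => //= ? ->.
(* Polarization frees one letter at a time: the trace vanishes with j + 1 equal letters in front of
   the remaining ones, and its derivative is j + 1 times the trace with one of them replaced by
   [z]. *)
have claim j l' y : (j + size l' = k.+1)%N -> \tr (wprod (nseq j y ++ l')) = 0.
  elim: l' j y => [|z l' IHl] j y.
    rewrite addn0 cats0 => ->; rewrite /wprod big_nseq.
    by have := killing0_nilpotent y k; rewrite -Monoid.iteropE.
  rewrite /= addnS => sz; have /eqP := diffE y z j.+1 l' sz.
  rewrite diff_trace0 => [|x].
    by have /pcharf0P natr0 := charF0; rewrite eq_sym mulf_eq0 natr0 /= => /eqP.
  rewrite -(IHl j.+1 x) ?addSn // wprod_cat; congr (\tr (_ *m _)).
  by rewrite /wprod big_nseq -Monoid.iteropE.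
by move=> sz; have := claim 0%N l 0; apply.
Qed.

End KillingZero.

Lemma killing_nondeg x : (forall y, killing x y = 0) -> x = 0.
Proof.
move=> kx; apply/eqP; apply: contraT => xn0.
pose P x := forall y, killing x y = 0.
have kill0 : forall x y, killing x y = 0.
  apply: (br_simple S (P := P)) xn0 kx; first split.
  - by move=> y; rewrite /killing ad0 mul0mx raddf0.
  - move=> a u v Pu Pv y; rewrite /killing adP mulmxDl -scalemxAl raddfD /= linearZ /=.
    by rewrite -!/(killing _ _) Pu Pv mulr0 addr0.
  - move=> u v Pv y; rewrite -(Pv (br y u)) /killing !ad_br mulmxBl mulmxBr !raddfB /=.
    by rewrite !mulmxA; congr (_ - _); rewrite -(mulmxA (ad u)) mxtrace_mulC.
have tr0 (M : 'M[F]_n.+1) : \tr M = 0.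
  pose Q (M : 'M[F]_n.+1) := \tr M = 0; apply: (ad_words_span (P := Q)).
    split=> [|a u v tu tv]; first by rewrite /Q raddf0.
    by rewrite /Q linearP /= tu tv mulr0 addr0.
  by case=> [//|y l] _; apply: (trace_word0 kill0 (k := size l)).
have := tr0 (delta_mx 0 0); rewrite /mxtrace (bigD1 0) //= big1 => [|i i0].
  by rewrite mxE eqxx addr0 => /eqP; rewrite oner_eq0.
by rewrite mxE (negPf i0).
Qed.

Definition killing_mx : 'M[F]_n.+1 :=
  \matrix_(i, j) killing (delta_mx 0 i) (delta_mx 0 j).

Lemma killing_mxE x y : killing x y = (x *m killing_mx *m y^T) 0 0.
Proof.
have killD a u v w : killing (a *: u + v) w = a * killing u w + killing v w.
  by rewrite /killing adP mulmxDl -scalemxAl raddfD /= linearZ.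
have killDr a u v w : killing w (a *: u + v) = a * killing w u + killing w v.
  by rewrite /killing adP mulmxDr -scalemxAr raddfD /= linearZ.
have kill0l w : killing 0 w = 0 by rewrite /killing ad0 mul0mx raddf0.
have kill0r w : killing w 0 = 0 by rewrite /killing ad0 mulmx0 raddf0.
have kill_suml w (a : 'I_n.+1 -> F) u :
    killing (\sum_i a i *: u i) w = \sum_i a i * killing (u i) w.
  by elim/big_rec2: _ => [|i c d _ <-]; rewrite ?kill0l ?killD.
have kill_sumr w (a : 'I_n.+1 -> F) u :
    killing w (\sum_i a i *: u i) = \sum_i a i * killing w (u i).
  by elim/big_rec2: _ => [|i c d _ <-]; rewrite ?kill0r ?killDr.
rewrite {1}[y]row_sum_delta kill_sumr mxE; apply: eq_bigr => j _.
rewrite mulrC; congr (_ * _); last by rewrite mxE.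
rewrite {1}[x]row_sum_delta kill_suml mxE; apply: eq_bigr => i _; by rewrite mxE.
Qed.

Lemma killing_mx_unit : killing_mx \in unitmx.
Proof.
rewrite -row_free_unit -kermx_eq0; apply/eqP/row_matrixP => i; rewrite row0.
apply: killing_nondeg => y; rewrite killing_mxE.
by rewrite (sub_kermxP (row_sub i _)) mul0mx mxE.
Qed.

End Killing.

(** * An alternating Lie polynomial *)

Section Alternating.
Variables (F : closedFieldType) (n : nat).
Local Notation V := 'rV[F]_n.+1.
Variables (br : V -> V -> V) (S : simple_bracket br).
Local Notation ad := (ad br).
Local Notation wprod := (wprod br).
Local Notation e := (fun i => delta_mx 0 i : V).

(** [ad] is injective, so the matrices ad(e_j) are independent, and n + 1 of their entries suffice
    to separate them. *)
Lemma ad_entries_unit : exists q p : 'I_n.+1 -> 'I_n.+1,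
  \det (\matrix_(k, j) ad (e j) (q k) (p k)) != 0.
Proof.
pose R := \matrix_(j < n.+1) mxvec (ad (e j)).
have Rfree : row_free R.
  rewrite -kermx_eq0; apply/eqP/row_matrixP => i; rewrite row0.
  set u := row i _; apply/eqP; rewrite -(ad_eq0 S) -(inj_eq (can_inj mxvecK)) linear0.
  have <- : u *m R = 0 by apply/sub_kermxP; exact: row_sub.
  apply/eqP; rewrite mulmx_sum_row [u in LHS]row_sum_delta.
  elim/big_rec2: _ => [|j y1 y2 _ <-]; first by rewrite (ad0 S) linear0.
  by rewrite (adP S) linearP rowK.
have RTfull : row_full R^T by rewrite /row_full mxrank_tr.
have [q [p qp]] : exists q p : 'I_n.+1 -> 'I_n.+1,
    forall k, fullrankfun RTfull k = mxvec_index (q k) (p k).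
  have /fin_all_exists[q qP] : forall k, exists i, exists j,
      fullrankfun RTfull k = mxvec_index i j.
    by move=> k; case/mxvec_indexP: (fullrankfun _ _) => i j; exists i, j.
  by have /fin_all_exists[p pP] := qP; exists q, p.
exists q, p; rewrite -unitfE -unitmxE -row_full_unit.
have := fullrowsub_full RTfull.
congr (is_true (row_full _)); apply/matrixP => k j.
by rewrite !mxE qp mxvecE mxE.
Qed.

(** The sum is linear in each surrounding matrix and words span all matrices, so the factors are
    freed one by one. While the later ones are treated, the first is absorbed into [c]; hence the
    matrix coefficients. *)
Lemma word_multilinear (c : 'S_n.+1 -> 'M[F]_n.+1) (l : seq 'I_n.+1) : uniq l ->
  (forall b b' : 'I_n.+1 -> seq V,
    \sum_s c s *m \prod_(k <- l) (wprod (b k) *m ad (e (s k)) *m wprod (b' k)) = 0) ->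
  forall E E' : 'I_n.+1 -> 'M[F]_n.+1,
    \sum_s c s *m \prod_(k <- l) (E k *m ad (e (s k)) *m E' k) = 0.
Proof.
elim: l c => [|k l IHl] c /=.
  move=> _ c0 E E'; rewrite -[RHS](c0 (fun=> [::]) (fun=> [::])).
  by apply: eq_bigr => s _; rewrite !big_nil.
case/andP=> kl ul c0 E E'.
pose Q W W' := \sum_s c s *m ((W *m ad (e (s k)) *m W') *m
  \prod_(k <- l) (E k *m ad (e (s k)) *m E' k)) = 0.
suff Q0 : Q (E k) (E' k) by rewrite -[RHS]Q0; apply: eq_bigr => s _; rewrite big_cons.
have wQ w w' : Q (wprod w) (wprod w').
  rewrite /Q; under eq_bigr do rewrite mulmxA.
  apply: (IHl (fun s => c s *m _)) => // b b'.
  pose upd f (w : seq V) i := if i == k then w else f i.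
  rewrite -[RHS](c0 (upd b w) (upd b' w')); apply: eq_bigr => s _.
  rewrite big_cons /upd eqxx -mulmxA; congr (_ *m (_ *m _)).
  rewrite !big_seq; apply: eq_bigr => i il.
  by have /negPf -> : i != k by apply: contraNneq kl => <-.
apply: (ad_words_span S (P := Q^~ (E' k))) => [|w _].
  split=> [|a u v Qu Qv]; first by apply: big1 => s _; rewrite !mul0mx mulmx0.
  rewrite /Q; under eq_bigr do rewrite !mulmxDl -!scalemxAl mulmxDr -scalemxAr.
  by rewrite big_split /= -scaler_sumr Qu Qv scaler0 addr0.
apply: (ad_words_span S (P := Q (wprod w))) => [|w' _ //].
split=> [|a u v Qu Qv]; first by apply: big1 => s _; rewrite mulmx0 mul0mx mulmx0.
rewrite /Q; under eq_bigr do rewrite mulmxDr -scalemxAr mulmxDl -scalemxAl mulmxDr -scalemxAr.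
by rewrite big_split /= -scaler_sumr Qu Qv scaler0 addr0.
Qed.

(** With the matrix units [E k] and [E' k] around ad(e_(s k)), the product collapses to the selected
    entries times [d0], and the alternating sum to the nonzero minor of [ad_entries_unit]. By
    [word_multilinear], words cannot all give zero. *)
Lemma alternating_words : exists b b' : 'I_n.+1 -> seq V,
  \sum_(s : 'S_n.+1) (-1) ^+ s *:
    \prod_k (wprod (b k) *m ad (e (s k)) *m wprod (b' k)) != 0.
Proof.
apply: contrapT => nob; have [q [p /negP]] := ad_entries_unit; apply.
pose E k : 'M[F]_n.+1 := delta_mx 0 (q k); pose E' k : 'M[F]_n.+1 := delta_mx (p k) 0.
have sum0 := word_multilinear (c := fun s => ((-1) ^+ s)%:M) (index_enum_uniq 'I_n.+1) _
  E E'.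
pose d0 : 'M[F]_n.+1 := delta_mx 0 0.
have d0X k : d0 ^+ k.+1 = d0.
  elim: k => [|k IHk]; first by rewrite expr1.
  by rewrite exprS IHk; exact: mul_delta_mx.
suff <- : (\sum_(s : 'S_n.+1) ((-1) ^+ s)%:M *m
   \prod_k (E k *m ad (e (s k)) *m E' k)) 0 0 =
   \det (\matrix_(k, j) ad (e j) (q k) (p k)).
  rewrite sum0 ?mxE // => b b'; apply/eqP; apply: contraT => bn0; case: nob.
  by exists b, b'; under eq_bigr do rewrite -mul_scalar_mx.
rewrite summxE; apply: eq_bigr => s _; rewrite mul_scalar_mx mxE; congr (_ * _).
under eq_bigr => k _.
  have -> : E k *m ad (e (s k)) *m E' k =
      ad (e (s k)) (q k) (p k) *: d0.
    rewrite /E /E' -(mul_delta_mx (0 : 'I_1) 0 (q k)) -(mul_delta_mx (0 : 'I_1) (p k) 0).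
    rewrite mulmxA -2!(mulmxA (delta_mx 0 0)) -rowE -colE [col _ _]mx11_scalar.
    by rewrite mul_mx_scalar -scalemxAl mul_delta_mx !mxE.
  over.
rewrite scaler_prod prodr_const card_ord d0X !mxE mulr1.
by apply: eq_bigr => k _; rewrite [RHS]mxE.
Qed.

End Alternating.

(** * Multilinear Lie polynomials as functions *)

Fixpoint magma_bind (Y Z : Type) (th : Y -> magma Z) (t : magma Y) : magma Z :=
  match t with
  | Gen y => th y
  | Op t1 t2 => Op (magma_bind th t1) (magma_bind th t2)
  end.

Lemma leaves_bind (Y Z : Type) (th : Y -> magma Z) t :
  leaves (magma_bind th t) = flatten [seq leaves (th y) | y <- leaves t].
Proof. by elim: t => [y|t1 IH1 t2 IH2] /=; rewrite ?cats0 // map_cat flatten_cat IH1 IH2. Qed.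

Lemma eq_eval_mon (F : fieldType) (Y : choiceType) (L : lmodType F) (mul : L -> L -> L)
    (x x' : Y -> L) t :
  {in leaves t, x =1 x'} -> eval_mon mul x t = eval_mon mul x' t.
Proof.
elim: t => [y|t1 IH1 t2 IH2] /= xx'; first by rewrite xx' ?inE.
by rewrite IH1 ?IH2 // => y yt; apply: xx'; rewrite mem_cat yt ?orbT.
Qed.

Section LieFun.
Variables (F : closedFieldType) (n : nat).
Local Notation V := 'rV[F]_n.+1.
Variables (br : V -> V -> V) (S : simple_bracket br).
Local Notation ad := (ad br).

Lemma eval_bind (Y Z : choiceType) (th : Y -> magma Z) (x : Z -> V) t :
  eval_mon br x (magma_bind th t) = eval_mon br (fun y => eval_mon br x (th y)) t.
Proof. by elim: t => //= t1 -> t2 ->. Qed.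

(* The function of x is a linear combination of bracket monomials, each using the
   variables of s exactly as often as they occur in s. *)
Definition lie_fun (Y : choiceType) (s : seq Y) (phi : (Y -> V) -> V) :=
  exists l : seq (F * magma Y), (forall p, p \in l -> perm_eq (leaves p.2) s) /\
    forall x, phi x = \sum_(p <- l) p.1 *: eval_mon br x p.2.

Lemma lie_fun_ext (Y : choiceType) (s : seq Y) phi psi :
  phi =1 psi -> lie_fun s phi -> lie_fun s psi.
Proof. by move=> pp [l [ls lE]]; exists l; split => // x; rewrite -pp. Qed.

Lemma lie_fun_perm (Y : choiceType) (s s' : seq Y) phi :
  perm_eq s s' -> lie_fun s phi -> lie_fun s' phi.
Proof.
move=> ss' [l [ls lE]]; exists l; split => // p /ls; by move/perm_trans; apply.
Qed.

Lemma lie_fun_gen (Y : choiceType) (y : Y) : lie_fun [:: y] (fun x => x y).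
Proof.
exists [:: (1, Gen y)]; split=> [p|x]; first by rewrite inE => /eqP ->.
by rewrite big_seq1 scale1r.
Qed.

Lemma lie_fun0 (Y : choiceType) (s : seq Y) : lie_fun s (fun=> 0).
Proof. by exists [::]; split=> // x; rewrite big_nil. Qed.

Lemma lie_funP (Y : choiceType) (s : seq Y) a phi psi :
  lie_fun s phi -> lie_fun s psi -> lie_fun s (fun x => a *: phi x + psi x).
Proof.
move=> [l [ls lE]] [l' [ls' lE']]; exists ([seq (a * p.1, p.2) | p <- l] ++ l'); split.
  by move=> p; rewrite mem_cat => /orP[/mapP[q /ls qs ->]|/ls'].
move=> x; rewrite big_cat big_map /= lE lE' scaler_sumr; congr (_ + _).
by apply: eq_bigr => p _; rewrite scalerA.
Qed.

Lemma lie_funZ (Y : choiceType) (s : seq Y) a phi :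
  lie_fun s phi -> lie_fun s (fun x => a *: phi x).
Proof.
move=> ps; apply: lie_fun_ext (lie_funP a ps (lie_fun0 s)) => x.
by rewrite addr0.
Qed.

Lemma lie_fun_sum (Y : choiceType) (s : seq Y) I (r : seq I) (c : I -> F) phi :
  (forall i, lie_fun s (phi i)) -> lie_fun s (fun x => \sum_(i <- r) c i *: phi i x).
Proof.
move=> phis; elim: r => [|i r IHr].
  by apply: lie_fun_ext (lie_fun0 s) => x; rewrite big_nil.
by apply: lie_fun_ext (lie_funP (c i) (phis i) IHr) => x; rewrite big_cons.
Qed.

Lemma lie_fun_br (Y : choiceType) (s s' : seq Y) phi psi :
  lie_fun s phi -> lie_fun s' psi -> lie_fun (s ++ s') (fun x => br (phi x) (psi x)).
Proof.
move=> [l [ls lE]] [l' [ls' lE']].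
exists [seq (p.1 * q.1, Op p.2 q.2) | p <- l, q <- l']; split.
  move=> p /allpairsP[[q q'] /= [ql ql' ->]] /=.
  by apply: perm_cat; [exact: ls|exact: ls'].
move=> x; rewrite lE lE' big_allpairs_dep /= (br_suml S); apply: eq_bigr => p _.
rewrite (br_sumr S); apply: eq_bigr => q _.
by rewrite (brZl S) (brZr S) scalerA.
Qed.

Lemma lie_fun_bind (Y Z : choiceType) (th : Y -> magma Z) (s : seq Y) phi :
  lie_fun s phi ->
  lie_fun (flatten [seq leaves (th y) | y <- s])
          (fun x => phi (fun y => eval_mon br x (th y))).
Proof.
move=> [l [ls lE]]; exists [seq (p.1, magma_bind th p.2) | p <- l]; split.
  move=> _ /mapP[p /ls ps ->] /=; rewrite leaves_bind.
  exact/perm_flatten/perm_map.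
by move=> x; rewrite lE big_map /=; apply: eq_bigr => p _; rewrite eval_bind.
Qed.

Lemma lie_fun_rename (Y Z : choiceType) (f : Y -> Z) (s : seq Y) phi :
  lie_fun s phi -> lie_fun (map f s) (fun x => phi (x \o f)).
Proof.
move/(lie_fun_bind (fun y => Gen (f y))) => /=.
by have -> : flatten [seq [:: f y] | y <- s] = map f s by elim: s => //= y s ->.
Qed.

Lemma lie_fun_words (Y : choiceType) (l s : seq Y) phi : lie_fun s phi ->
  lie_fun (l ++ s) (fun x => phi x *m \prod_(y <- l) ad (x y)).
Proof.
elim: l s phi => [|y l IHl] s phi ps.
  by apply: lie_fun_ext ps => x; rewrite big_nil mulmx1.
have /IHl : lie_fun (y :: s) (fun x => phi x *m ad (x y)).
  apply: lie_fun_ext (lie_fun_br (lie_fun_gen y) ps) => x.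
  by rewrite (mul_ad S).
move/(@lie_fun_perm _ _ (y :: l ++ s)) => H; apply: lie_fun_ext (H _) => [x|].
  by rewrite big_cons -mulmxA.
by rewrite -cat1s perm_catCA.
Qed.

End LieFun.

(** Both sides are the derivative of det(Z (1 + c T)) at c = 0. *)
Lemma sum_det_mul_row (R : comNzRingType) n (Z T : 'M[R]_n) :
  \sum_i \det (\matrix_(j, k) (if j == i then (Z *m T) i k else Z j k)) = \tr T * \det Z.
Proof.
transitivity (\sum_i \sum_k (Z *m T) i k * cofactor Z i k).
  apply: eq_bigr => i _; rewrite (expand_det_row _ i); apply: eq_bigr => k _.
  rewrite mxE eqxx; congr (_ * (_ * \det _)).
  by apply/matrixP => j l; rewrite !mxE eq_sym (negPf (neq_lift _ _)).
transitivity (\tr (Z *m T *m \adj Z)).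
  by apply: eq_bigr => i _; rewrite [RHS]mxE; apply: eq_bigr => k _; rewrite [\adj _ _ _]mxE.
by rewrite mxtrace_mulC mulmxA mul_adj_mx mul_scalar_mx linearZ /= mulrC.
Qed.

Section Core.
Variables (F : closedFieldType) (n : nat).
Local Notation V := 'rV[F]_n.+1.
Local Notation I := 'I_n.+1.
Variables (br : V -> V -> V) (S : simple_bracket br).
Variables b b' : I -> seq V.
Local Notation ad := (ad br).
Local Notation e := (fun i => delta_mx 0 i : V).

(* The variables of the alternating polynomial: None is the vector acted upon, inl i is
   the i-th alternating variable, and inr (k, c, i) is the i-th letter of the word
   surrounding the k-th alternating variable on the left (c = false, value in b k) or on
   the right (c = true, value in b' k). *)
Definition clabel : Type := option (I + I * bool * nat).
HB.instance Definition _ := Choice.on clabel.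

Definition zlab (i : I) : clabel := Some (inl i).
Definition wlab (k : I) (c : bool) : seq clabel :=
  [seq Some (inr (k, c, i)) | i <- iota 0 (size (if c then b' k else b k))].

Definition core_word (s : 'S_n.+1) : seq clabel :=
  flatten [seq wlab k false ++ zlab (s k) :: wlab k true | k <- index_enum I].

Definition core_rest : seq clabel :=
  None :: flatten [seq wlab k false ++ wlab k true | k <- index_enum I].

Definition core_labels : seq clabel := map zlab (index_enum I) ++ core_rest.

Lemma core_word_perm s : perm_eq (core_word s ++ [:: None]) core_labels.
Proof.
apply/seq.permP => a; rewrite /core_labels /core_rest -(cat1s None (flatten _)).
rewrite !count_cat [RHS]addnCA [LHS]addnC; congr (_ + _)%N.
rewrite /core_word !count_flatten count_map !sumnE !big_map.
rewrite -[count (preim _ _) _]sum1_count [X in _ = (X + _)%N]big_mkcond /=.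
rewrite [X in _ = (X + _)%N](reindex_inj (perm_inj (s := s))) -big_split; apply: eq_bigr => k _ /=.
by rewrite !count_cat /= addnCA; congr (_ + _)%N; case: (a _).
Qed.

Definition core_prod (x : clabel -> V) (s : 'S_n.+1) : 'M[F]_n.+1 :=
  \prod_(y <- core_word s) ad (x y).

Definition core_fun (x : clabel -> V) : V :=
  \sum_(s : 'S_n.+1) (-1) ^+ s *: (x None *m core_prod x s).

Lemma core_lie_fun : lie_fun br core_labels core_fun.
Proof.
apply: lie_fun_sum => s; apply: (lie_fun_perm (core_word_perm s)).
exact: lie_fun_words (lie_fun_gen _ _).
Qed.

Definition base_z (x : clabel -> V) (y : clabel) : V :=
  if y is Some (inl i) then e i else x y.

Definition zmat (x : clabel -> V) : 'M[F]_n.+1 := \matrix_i x (zlab i).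

Definition core_factor (x : clabel -> V) (M : 'M[F]_n.+1) (k : I) : 'M[F]_n.+1 :=
  \prod_(y <- wlab k false) ad (x y) *m M *m \prod_(y <- wlab k true) ad (x y).

Lemma core_prodE x s : core_prod x s = \prod_k core_factor x (ad (x (zlab (s k)))) k.
Proof.
rewrite /core_prod /core_word big_flatten big_map; apply: eq_bigr => k _.
by rewrite big_cat big_cons /= /core_factor -mulmxA.
Qed.

(** Expanding the alternating variables in the basis pulls out the determinant and leaves [Q], which
    involves only the other variables and so agrees at [x] and [base_z x]. *)
Lemma core_funE x : core_fun x = \det (zmat x) *: core_fun (base_z x).
Proof.
pose Q x := \sum_(f : {ffun I -> I}) \det (\matrix_(k, j) (j == f k)%:R : 'M[F]_n.+1) *:
  (x None *m \prod_k core_factor x (ad (e (f k))) k).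
have QE x' : core_fun x' = \det (zmat x') *: Q x'.
  rewrite /Q scaler_sumr /core_fun.
  transitivity (\sum_(s : 'S_n.+1) \sum_(f : {ffun I -> I})
     ((-1) ^+ s * \prod_k zmat x' (s k) (f k)) *: 
       (x' None *m \prod_k core_factor x' (ad (e (f k))) k)).
    apply: eq_bigr => s _; rewrite core_prodE.
    under eq_bigr => k _.
      have -> : core_factor x' (ad (x' (zlab (s k)))) k =
          \sum_j zmat x' (s k) j *: core_factor x' (ad (e j)) k.
        rewrite /core_factor [x' (zlab (s k))]row_sum_delta.
        have -> : ad (\sum_j x' (zlab (s k)) 0 j *: 'e_j) = \sum_j zmat x' (s k) j *: ad (e j).
          elim/big_rec2: _ => [|j y1 y2 _ <-]; first exact: ad0 S.
          by rewrite (adP S) !mxE.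
        rewrite mulmx_sumr mulmx_suml; apply: eq_bigr => j _.
        by rewrite -scalemxAr -scalemxAl.
      over.
    rewrite /= bigA_distr_bigA mulmx_sumr scaler_sumr; apply: eq_bigr => f _.
    by rewrite scaler_prod -scalemxAr scalerA.
  rewrite exchange_big; apply: eq_bigr => f _ /=.
  rewrite -scaler_suml scalerA; congr (_ *: _).
  rewrite mulrC -(det_tr (zmat x')) -det_mulmx.
  apply: eq_bigr => s _; congr (_ * _); apply: eq_bigr => k _.
  rewrite [RHS]mxE (bigD1 (f k)) //= big1 => [|j /negPf jf]; last by rewrite mxE jf mul0r.
  by rewrite !mxE eqxx mul1r addr0.
rewrite !QE; have -> : zmat (base_z x) = 1%:M.
  by apply/row_matrixP => i; rewrite rowK row1.
rewrite det1 scale1r; congr (_ *: _); apply: eq_bigr => f _; congr (_ *: (_ *m _)).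
apply: eq_bigr => k _; rewrite /core_factor; congr (_ *m _ *m _).
  by rewrite !big_map.
by rewrite !big_map.
Qed.

Definition upd_z (x : clabel -> V) (i : I) (v : V) (y : clabel) : V :=
  if y == zlab i then v else x y.

(* Razmyslov's trick: summing the substitutions of z_i T for z_i multiplies an alternating
   function of all the z_i by the trace of T. *)
Lemma core_fun_trace x (T : 'M[F]_n.+1) :
  \sum_i core_fun (upd_z x i (x (zlab i) *m T)) = \tr T *: core_fun x.
Proof.
transitivity (\sum_i \det (\matrix_(j, k) (if j == i then (zmat x *m T) i k else zmat x j k))
    *: core_fun (base_z x)).
  apply: eq_bigr => i _; rewrite core_funE; congr (\det _ *: _).
    apply/matrixP => j k; have zE : (zlab j == zlab i) = (j == i) by [].
    rewrite !mxE /upd_z zE; case: (eqVneq j i) => [_|//].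
    by rewrite mxE; apply: eq_bigr => l _; rewrite mxE.
  rewrite /core_fun; apply: eq_bigr => s _; congr (_ *: (_ *m _)).
  apply: eq_bigr => y _; by case: y => [[]|].
by rewrite -scaler_suml sum_det_mul_row -scalerA -core_funE.
Qed.

Lemma core_fun_neq0 :
  \sum_(s : 'S_n.+1) (-1) ^+ s *:
    \prod_k (wprod br (b k) *m ad (e (s k)) *m wprod br (b' k)) != 0 ->
  exists x, zmat x = 1%:M /\ core_fun x != 0.
Proof.
move=> M0; set M := \sum_s _ in M0.
have [u uM] : exists u : V, u *m M != 0.
  apply: contrapT => allu; move/negP: M0; apply; apply/eqP/eq_mul_row => u.
  by rewrite mulmx0; apply/eqP; apply: contraT => uM; case: allu; exists u.
pose x (y : clabel) : V := match y with
  | None => u | Some (inl i) => e i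
  | Some (inr (k, c, i)) => nth 0 (if c then b' k else b k) i end.
exists x; split; first by apply/row_matrixP => i; rewrite rowK row1.
suff -> : core_fun x = u *m M by [].
rewrite /M mulmx_sumr; apply: eq_bigr => s _; rewrite -scalemxAr; congr (_ *: (_ *m _)).
rewrite core_prodE; apply: eq_bigr => k _; rewrite /core_factor /wprod /wlab !big_map /=.
by rewrite -[b k in RHS](mkseq_nth 0) -[b' k in RHS](mkseq_nth 0) !big_map.
Qed.

End Core.

(** * Products of determinants as multipliers *)

Lemma perm_flatten_if (Y : eqType) (a b z : Y) (s : seq Y) : count_mem z s = 1%N ->
  perm_eq (flatten [seq if y == z then [:: a; b; y] else [:: y] | y <- s]) [:: a, b & s].
Proof.
move=> sz; apply/seq.permP => P.
suff -> : count P (flatten [seq if y == z then [:: a; b; y] else [:: y] | y <- s]) =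
    (count_mem z s * (P a + P b) + count P s)%N by rewrite sz mul1n -addnA.
elim: s {sz} => [|y s IHs] //=; rewrite count_cat IHs mulnDl.
by case: eqP => _ /=; rewrite ?mul1n ?mul0n ?addn0 ?add0n ?addnA; lia.
Qed.

Section Scal.
Variables (F : closedFieldType) (n : nat).
Hypothesis charF0 : [pchar F] =i pred0.
Local Notation V := 'rV[F]_n.+1.
Local Notation I := 'I_n.+1.
Variables (br : V -> V -> V) (S : simple_bracket br).
Variables b b' : I -> seq V.
Local Notation ad := (ad br).
Local Notation core_labels := (core_labels b b').
Local Notation core_fun := (core_fun br b b').
Variable C : choiceType.
Local Notation Y := (clabel n + C)%type.

Definition scal_labels (l : seq C) : seq Y := map inr l ++ map inl core_labels.

Definition scal_fun (a : (C -> V) -> F) (x : Y -> V) : V :=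
  a (x \o inr) *: core_fun (x \o inl).

(* Multiplication by a, a function multilinear in the variables of l, preserves the
   multiples of core_fun that are Lie functions. *)
Definition scal (l : seq C) (a : (C -> V) -> F) := forall m c,
  lie_fun br (scal_labels m) (scal_fun c) ->
  lie_fun br (scal_labels (l ++ m)) (scal_fun (fun x => a x * c x)).

Lemma scal_ext l a a' : a =1 a' -> scal l a -> scal l a'.
Proof.
move=> aa sa m c /sa; apply: lie_fun_ext => x.
by rewrite /scal_fun aa.
Qed.

Lemma scal_perm l l' a : perm_eq l l' -> scal l a -> scal l' a.
Proof.
move=> ll sa m c /sa; apply: lie_fun_perm.
by rewrite perm_cat2r; apply: perm_map; rewrite perm_cat2r.
Qed.

Lemma scal1 : scal [::] (fun=> 1).
Proof. by move=> m c; apply: lie_fun_ext => x; rewrite /scal_fun mul1r. Qed.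

Lemma scalM l l' a a' : scal l a -> scal l' a' -> scal (l ++ l') (fun x => a x * a' x).
Proof.
move=> sa sa' m c /sa' /sa; rewrite catA; apply: lie_fun_ext => x.
by rewrite /scal_fun mulrA.
Qed.

Lemma scal_sum l I (r : seq I) (k : I -> F) a : (forall i, scal l (a i)) ->
  scal l (fun x => \sum_(i <- r) k i * a i x).
Proof.
move=> sa m c mc; have := lie_fun_sum r k (fun i => sa i m c mc).
apply: lie_fun_ext => x; rewrite /scal_fun mulr_suml scaler_suml.
by apply: eq_bigr => i _; rewrite scalerA mulrA.
Qed.

Lemma scalZ l k a : scal l a -> scal l (fun x => k * a x).
Proof.
move=> sa; apply: scal_ext (scal_sum [:: tt] (fun=> k) (fun=> sa)) => x.
by rewrite big_seq1.
Qed.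

Lemma scal_prod I (r : seq I) l a : (forall i, scal (l i) (a i)) ->
  scal (flatten [seq l i | i <- r]) (fun x => \prod_(i <- r) a i x).
Proof.
move=> sa; elim: r => [|i r IHr].
  by apply: scal_ext scal1 => x; rewrite big_nil.
by apply: scal_ext (scalM (sa i) IHr) => x; rewrite big_cons.
Qed.

Lemma scal_labels_count m i : count_mem (inl (zlab i)) (scal_labels m) = 1%N.
Proof.
rewrite /scal_labels /core_labels /core_rest !map_cat !count_cat !count_map /=.
rewrite [count _ m](_ : _ = 0)%N ?add0n; last first.
  by apply/eqP; rewrite -leqn0 leqNgt -has_count; apply/hasPn.
rewrite [X in (_ + X)%N](_ : _ = 0)%N ?addn0.
  have := count_uniq_mem i (index_enum_uniq I); rewrite mem_index_enum; apply: etrans.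
  exact: eq_count.
apply/eqP; rewrite -leqn0 leqNgt -has_count; apply/hasPn => y.
by move=> /flattenP[_ /mapP[k _ ->]]; rewrite mem_cat => /orP[]/mapP[j _ ->].
Qed.

(** Substitute [u, [v, z_i]] for z_i, which occurs exactly once in each monomial, and sum over i:
    [core_fun_trace] gives the trace. The factor [c] is unaffected, since its variables are the
    [inr] ones. *)
Lemma scal_killing u v : scal [:: u; v] (fun x => killing br (x u) (x v)).
Proof.
move=> m c mc.
pose th i (y : Y) : magma Y := if y == inl (zlab i)
  then Op (Gen (inr u)) (Op (Gen (inr v)) (Gen y)) else Gen y.
have thP i : lie_fun br (scal_labels ([:: u; v] ++ m))
    (fun x => 1 *: scal_fun c (fun y => eval_mon br x (th i y))).
  apply: lie_funZ; apply: lie_fun_perm (lie_fun_bind (th i) mc).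
  have -> : [seq leaves (th i y) | y <- scal_labels m] =
      [seq if y == inl (zlab i) then [:: inr u; inr v; y] else [:: y] | y <- scal_labels m].
    by apply: eq_map => y; rewrite /th; case: eqP.
  exact: perm_flatten_if (scal_labels_count _ _).
have := lie_fun_sum (index_enum I) (fun=> 1) thP; apply: lie_fun_ext => x.
transitivity (\sum_i c (x \o inr) *:
    core_fun (upd_z (x \o inl) i (x (inl (zlab i)) *m (ad (x (inr v)) *m ad (x (inr u)))))).
  apply: eq_bigr => i _; rewrite !scale1r /scal_fun; congr (_ *: core_fun _).
  apply/funext => y /=; rewrite /th /upd_z -[inl y == _]/(y == zlab i).
  by case: eqP => [->|//]; rewrite /= mulmxA !(mul_ad S).
rewrite -scaler_sumr (core_fun_trace S) /scal_fun scalerA; congr (_ *: _).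
by rewrite mulrC /killing mxtrace_mulC.
Qed.

Definition rows_mx (u : I -> C) (x : C -> V) : 'M[F]_n.+1 := \matrix_i x (u i).

(** Up to the nonzero determinant of [killing_mx], this is the Gram determinant of the Killing form,
    whose Leibniz expansion is a sum of products of multipliers. *)
Lemma scal_det (u v : I -> C) :
  scal (map u (index_enum I) ++ map v (index_enum I))
       (fun x => \det (rows_mx u x) * \det (rows_mx v x)).
Proof.
have K0 : \det (killing_mx br) != 0.
  by rewrite -unitfE -unitmxE; apply: killing_mx_unit.
have detE x : \det (killing_mx br) * (\det (rows_mx u x) * \det (rows_mx v x)) =
    \sum_(s : 'S_n.+1) (-1) ^+ s * \prod_i killing br (x (u i)) (x (v (s i))).
  rewrite mulrCA mulrA -(det_tr (rows_mx v x)) -!det_mulmx.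
  apply: eq_bigr => s _; congr (_ * _); apply: eq_bigr => i _.
  rewrite (killing_mxE S).
  rewrite [LHS]mxE [RHS]mxE; apply: eq_bigr => k _; congr (_ * _); last by rewrite !mxE.
  by rewrite [LHS]mxE [RHS]mxE; apply: eq_bigr => l _; rewrite [rows_mx _ _ _ _]mxE.
apply: (scal_ext (a := fun x => (\det (killing_mx br))^-1 *
    \sum_(s : 'S_n.+1) (-1) ^+ s * \prod_i killing br (x (u i)) (x (v (s i))))).
  by move=> x; rewrite -detE mulKf.
apply: scalZ; apply: scal_sum => s.
apply: scal_perm (scal_prod (index_enum I) (fun i => scal_killing (u i) (v (s i)))).
apply/seq.permP => P; rewrite count_flatten count_cat !count_map !sumnE !big_map.
rewrite -!sum1_count [X in _ = (X + _)%N]big_mkcond [X in _ = (_ + X)%N]big_mkcond /=.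
rewrite [X in _ = (_ + X)%N](reindex_inj (perm_inj (s := s))) -big_split /=.
by apply: eq_bigr => i _; rewrite addn0; do 2 case: (P _).
Qed.

Lemma scal_lie_fun l a : scal l a -> lie_fun br (scal_labels l) (scal_fun a).
Proof.
move=> /(_ [::] (fun=> 1)); rewrite cats0 => H; apply: lie_fun_ext (H _) => [x|].
  by rewrite /scal_fun mulr1.
apply: lie_fun_ext (lie_fun_rename inl (core_lie_fun S b b')) => x.
by rewrite /scal_fun scale1r.
Qed.

End Scal.

(** * Block words *)

Lemma eq_fibers_perm (P : finType) (I : eqType) (f g : P -> I) :
  (forall i, #|[pred p | f p == i]| = #|[pred p | g p == i]|) ->
  exists s : {perm P}, forall p, f (s p) = g p.
Proof.
move=> fg.
have /tuple_permP[s sP] : perm_eq (codom_tuple g) (codom_tuple f).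
  have cnt (h : P -> I) i : count_mem i (codom h) = #|[pred p | h p == i]|.
    rewrite cardE /codom /image_mem count_map -size_filter /enum_mem -filter_predI.
    by congr size; apply: eq_filter => p; rewrite !inE andbT.
  by apply/allP => i _ /=; rewrite !cnt fg.
have s_inj : injective (fun p => enum_val (s (enum_rank p))).
  by move=> p p' /enum_val_inj /perm_inj /enum_rank_inj.
exists (perm s_inj) => p; rewrite permE.
have := congr1 (fun t : seq I => nth (g p) t (enum_rank p)) sP.
rewrite nth_codom enum_rankK -tnth_nth tnth_mktuple (tnth_nth (g p)) => ->.
by rewrite nth_codom.
Qed.

Definition balanced (K : finType) n (w : {ffun K * 'I_n.+1 -> 'I_n.+1}) : bool :=
  [forall i, #|[pred p | w p == i]| == #|K|].

(* By the pigeonhole principle many words share the same letter counts; concatenating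
   n.+1 of them, with the letters of the j-th one shifted cyclically by j, gives a
   balanced word. *)
Lemma card_balanced (K : finType) n : exists a : nat,
  (n.+1 ^ #|K| <= #|K|.+1 ^ n.+1 * a)%N /\
  (a ^ n.+1 <= #|@balanced K n|)%N.
Proof.
pose typ (u : {ffun K -> 'I_n.+1}) : {ffun 'I_n.+1 -> 'I_#|K|.+1} :=
  [ffun i => inord #|[pred k | u k == i]|].
pose A k := [pred u | typ u == k].
have [ka kaP] : exists ka, forall k', (#|A k'| <= #|A ka|)%N.
  have [ka _ kaP] := @arg_maxnP _ (finfun (fun=> ord0)) xpredT (fun k => #|A k|) isT.
  by exists ka => k'; exact: kaP.
exists #|A ka|; split.
  have -> : (n.+1 ^ #|K| = \sum_(k : {ffun 'I_n.+1 -> 'I_#|K|.+1}) #|A k|)%N.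
    have <- : #|{ffun K -> 'I_n.+1}| = (n.+1 ^ #|K|)%N by rewrite card_ffun card_ord.
    rewrite -sum1_card (partition_big typ xpredT) //=; apply: eq_bigr => k _.
    by rewrite sum1_card; apply: eq_card => u; rewrite !inE.
  apply: leq_trans (leq_sum _ (fun k _ => kaP k)) _.
  by rewrite sum_nat_const card_ffun !card_ord.
pose T := {u | u \in A ka}.
pose w (f : {ffun 'I_n.+1 -> T}) : {ffun K * 'I_n.+1 -> 'I_n.+1} :=
  [ffun p => val (f p.2) p.1 + p.2].
have w_inj : injective w.
  move=> f g fg; apply/ffunP => j; apply: val_inj; apply/ffunP => k.
  by have /ffunP/(_ (k, j)) := fg; rewrite !ffunE => /addIr.
have -> : (#|A ka| ^ n.+1 = #|codom w|)%N.
  by rewrite card_codom // card_ffun card_ord card_sig.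
apply/subset_leq_card/fintype.subsetP => _ /codomP[f ->]; apply/forallP => i; apply/eqP.
have typE (u : T) j : #|[pred k | val u k == j]| = ka j.
  have /eqP/ffunP/(_ j) := valP u; rewrite ffunE => <-.
  by rewrite inordK // ltnS max_card.
rewrite -sum1_card (partition_big snd xpredT) //=.
transitivity (\sum_j (ka (i - j)%R : nat)).
  apply: eq_bigr => j _; rewrite -(typE (f j)) -sum1_card.
  rewrite (reindex_onto (fun k => (k, j)) fst) /=; last by move=> [k j'] /andP[_ /eqP <-].
  by apply: eq_bigl => k; rewrite !inE ffunE /= !eqxx !andbT [RHS]eq_sym subr_eq [RHS]eq_sym.
rewrite (reindex_inj (inv_inj (subKr i))) /=.
under eq_bigr do rewrite subKr -(typE (f ord0)) -sum1_card.
rewrite -sum1_card [RHS](partition_big (val (f ord0)) xpredT) //=.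
Qed.

Lemma balancedP (K : finType) n (w : {ffun K * 'I_n.+1 -> 'I_n.+1}) :
  balanced w -> exists s : {perm K * 'I_n.+1}, forall p, w (s p) = p.2.
Proof.
move=> /forallP wb; apply: eq_fibers_perm => i; rewrite (eqP (wb i)).
rewrite -sum1_card -[RHS]sum1_card (reindex_onto (fun k => (k, i)) fst) /=.
  by apply: eq_bigl => k; rewrite !inE /= !eqxx.
by move=> [k j] /eqP /= <-.
Qed.

Lemma balanced_snd (K : finType) n : balanced [ffun p : K * 'I_n.+1 => p.2].
Proof.
apply/forallP => i; rewrite -sum1_card -[X in _ == X]sum1_card.
rewrite (reindex_onto (fun k => (k, i)) fst) /=.
  by apply/eqP/eq_bigl => k; rewrite !inE /= ffunE /= !eqxx.
by move=> [k j]; rewrite inE ffunE /= => /eqP <-.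
Qed.

Section BlockWords.
Variables (K : finType) (n N : nat).
Local Notation I := 'I_n.+1.
Local Notation P := (K * I)%type.
Local Notation word := {ffun P -> I}.

(* The i-th letter of the column (t, k) sits in block t + i (modulo N.+1), at a
   position that the balanced word of that block assigns to the letter i. *)
Definition col_label (s : 'I_N.+1 -> {perm P}) (c : 'I_N.+1 * K) (i : I) : 'I_N.+1 * P :=
  let t := c.1 + inZp i in (t, s t (c.2, i)).

(** Ensures that the product of the determinants of all columns is multilinear in the positions. *)
Lemma col_label_perm s :
  perm_eq (flatten [seq [seq col_label s c i | i <- index_enum I] | c <- index_enum _])
          (index_enum _).
Proof.
apply: uniq_perm; [|exact: index_enum_uniq|].
  apply/allpairs_uniq; rewrite ?index_enum_uniq // => -[[t k] i] [[t' k'] i'] _ _ E.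
  have tt' : t + inZp i = t' + inZp i' := congr1 fst E.
  have : s (t + inZp i) (k, i) = s (t' + inZp i') (k', i') := congr1 snd E.
  by rewrite tt' => /perm_inj[-> ii']; move: tt'; rewrite ii' => /addIr ->.
move=> [t p]; rewrite mem_index_enum; set k := (s t)^-1%g p.
apply/allpairsP; exists ((t - inZp k.2, k.1), k.2); split; rewrite ?mem_index_enum //=.
by rewrite /col_label /= subrK -surjective_pairing permKV.
Qed.

(* By induction on the block: the letters below i of a column lie in earlier blocks, so
   the i-th entry of the column is read by w' as a letter at least i; as w and w' are both
   balanced, the letters of the block have the same sum, which forces equality. *)
Lemma block_words_eq (w w' : 'I_N.+1 -> word) (s s' : 'I_N.+1 -> {perm P}) :
  (forall t p, w t (s t p) = p.2) -> (forall t p, w' t (s' t p) = p.2) ->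
  (forall t : 'I_N.+1, (t < n)%N -> w' t = w t) ->
  (forall c, injective (fun i => let l := col_label s c i in w' l.1 l.2)) ->
  forall t, w' t = w t.
Proof.
move=> ws ws' ww' w'inj.
suff H m : forall t : 'I_N.+1, (t < m)%N -> forall p, w' t (s t p) = p.2.
  move=> t; apply/ffunP => p; rewrite -[p](permKV (s t)) ws.
  exact: H (leqnn _) _.
elim: m => // m IHm t; rewrite ltnS leq_eqVlt => /predU1P[tm|]; last exact: IHm.
have [tn|nt] := ltnP t n; first by move=> p; rewrite ww' // ws.
have geP (p : P) : (p.2 <= w' t (s t p))%N.
  rewrite leqNgt; apply/negP => lt_i.
  set i' := w' t (s t p) in lt_i.
  have le_i : (p.2 <= t)%N by rewrite (leq_trans _ nt) // -ltnS.
  (* The block where the column through this letter starts. As p.2 <= n <= t, there is no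
     wrap-around up to block t, and the smaller letters of the column lie in blocks already
     treated. *)
  pose t0 : 'I_N.+1 := t - inZp p.2.
  have t0E (i : I) : (i <= p.2)%N -> (t0 + inZp i : 'I_N.+1) = (t - p.2 + i)%N :> nat.
    move=> ip; have -> : t0 = inZp (t - p.2).
      apply/eqP; rewrite subr_eq; apply/eqP/val_inj.
      by rewrite /= modnDm subnK // modn_small.
    by rewrite /= modnDm modn_small //; have := ltn_ord t; lia.
  have tE : t0 + inZp p.2 = t by rewrite subrK.
  have t1m : ((t0 + inZp i')%R < m)%N by rewrite t0E ?(ltnW lt_i) // -tm; lia.
  suff ii' : i' = p.2 by move: lt_i; rewrite ii' ltnn.
  apply: (w'inj (t0, p.1)); rewrite /col_label /= IHm // tE.
  by rewrite -surjective_pairing.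
have sumE : (\sum_p w' t (s t p) = \sum_(p : P) p.2)%N.
  transitivity (\sum_p (w' t p : nat))%N.
    by rewrite [RHS](reindex_inj (perm_inj (s := s t))).
  rewrite (reindex_inj (perm_inj (s := s' t))) /=.
  by apply: eq_bigr => p _; rewrite ws'.
move=> p; apply/val_inj/eqP; rewrite eqn_leq geP andbT leqNgt; apply/negP => lt_p.
have : (\sum_(p : P) p.2 < \sum_p w' t (s t p))%N.
  rewrite (bigD1 p) //= [X in (_ < X)%N](bigD1 p) //= -addSn leq_add //.
  exact: leq_sum.
by rewrite sumE ltnn.
Qed.

End BlockWords.

(** * Linearly independent Lie functions and the lower bound *)

Section LieRank.
Variables (F : closedFieldType) (n : nat).
Local Notation V := 'rV[F]_n.+1.
Variables (br : V -> V -> V) (S : simple_bracket br).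

Definition indep_lie (Y : choiceType) (s : seq Y) (T : finType)
    (phi : T -> (Y -> V) -> V) :=
  (forall t, lie_fun br s (phi t)) /\
  forall c : T -> F, (forall x, \sum_t c t *: phi t x = 0) -> forall t, c t = 0.

Definition lie_rank (m r : nat) :=
  exists phi : 'I_r -> (nat -> V) -> V, indep_lie (iota 0 m) phi.

Lemma lie_fun_local (Y : choiceType) (s : seq Y) phi x x' :
  lie_fun br s phi -> {in s, x =1 x'} -> phi x = phi x'.
Proof.
move=> [l [ls lE]] xx'; rewrite !lE !big_seq; apply: eq_bigr => p /ls ps.
by congr (_ *: _); apply: eq_eval_mon => y; rewrite (perm_mem ps); exact: xx'.
Qed.

Lemma indep_lie_rename (Y Z : choiceType) (z0 : Z) (s : seq Y) (s' : seq Z)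
    (T : finType) (phi : T -> (Y -> V) -> V) :
  uniq s -> uniq s' -> size s = size s' -> indep_lie s phi ->
  indep_lie s' (fun t x => phi t (fun y => x (nth z0 s' (index y s)))).
Proof.
move=> us us' ss' [phis phi_free]; split=> [t|c c0].
  have := lie_fun_rename (fun y => nth z0 s' (index y s)) (phis t).
  congr lie_fun; apply: (@eq_from_nth _ z0); rewrite size_map // => i si.
  case: s us ss' {phis phi_free} si => // y0 s us ss' si.
  by rewrite (nth_map y0) // index_uniq.
apply: phi_free => x; rewrite -[RHS](c0 (fun z => nth 0 (map x s) (index z s'))).
apply: eq_bigr => t _; congr (_ *: _); apply: (lie_fun_local (phis t)) => y ys.
by rewrite index_uniq -?ss' ?index_mem // (nth_map y) ?index_mem // nth_index.
Qed.

Lemma lie_rankP (Y : choiceType) (s : seq Y) (T : finType) (phi : T -> (Y -> V) -> V) :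
  uniq s -> indep_lie s phi -> lie_rank (size s) #|T|.
Proof.
move=> us phis.
have [psis psi_free] :=
  indep_lie_rename 0%N us (iota_uniq 0 (size s)) (esym (size_iota _ _)) phis.
eexists; split=> [i|c c0 i]; first exact: (psis (enum_val i)).
rewrite -[i]enum_valK; apply: (psi_free (c \o enum_rank)) => x.
rewrite -[RHS](c0 x) (reindex_onto _ _ (fun i _ => enum_rankK i)) /=.
apply: eq_big => [j|j _]; by rewrite enum_valK ?eqxx.
Qed.

(** Bracketing with a fresh variable preserves independence because the centre is zero; this pads
    the block construction to any number of variables. *)
Lemma lie_rankS m r : lie_rank m r -> lie_rank m.+1 r.
Proof.
move=> [phi [phis phi_free]].
exists (fun i x => phi i x *m ad br (x m)); split=> [i|c c0].
  have -> : iota 0 m.+1 = iota 0 m ++ [:: m] by rewrite -[m.+1]addn1 iotaD.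
  have H := lie_fun_words S [:: m] (phis i); apply: (lie_fun_perm _ (lie_fun_ext _ H)) => [|x].
    by rewrite perm_catC.
  by rewrite big_seq1.
apply: phi_free => x; set w := \sum_t _.
apply/eqP; rewrite -(ad_eq0 S); apply/eqP/eq_mul_row => u; rewrite mulmx0 (mul_ad S).
rewrite (brC S) -(mul_ad S) /w mulmx_suml.
rewrite -[RHS]oppr0 -[in RHS](c0 (fun j => if j == m then u else x j)); congr (- _).
apply: eq_bigr => i _; rewrite eqxx scalemxAl; congr (_ *: _ *m _).
apply: (lie_fun_local (phis i)) => j; rewrite mem_iota add0n => /andP[_ jm].
by rewrite ltn_eqF.
Qed.

Lemma lie_rank_leq m m' r : (m <= m')%N -> lie_rank m r -> lie_rank m' r.
Proof.
move/subnKC <-; elim: (m' - m)%N => [|k IHk] rk; first by rewrite addn0.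
by rewrite addnS; exact/lie_rankS/IHk.
Qed.

End LieRank.

Lemma big_pair_bool (R : Type) (idx : R) (op : Monoid.com_law idx) (T Q : finType)
    (G : T * (Q * bool) -> R) :
  \big[op/idx]_c G c =
  \big[op/idx]_(c : T * Q) op (G (c.1, (c.2, false))) (G (c.1, (c.2, true))).
Proof.
rewrite (eq_bigr (fun c => G (c.1, c.2))) => [|[] //].
rewrite -(pair_bigA _ (fun t k => G (t, k))) /=.
rewrite -(pair_bigA _ (fun t q => op (G (t, (q, false))) (G (t, (q, true))))) /=.
apply: eq_bigr => t _; rewrite (eq_bigr (fun k => G (t, (k.1, k.2)))) => [|[] //].
rewrite -(pair_bigA _ (fun q c => G (t, (q, c)))) /=.
by apply: eq_bigr => q _; rewrite big_bool Monoid.mulmC.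
Qed.

Lemma core_labels_uniq (F : closedFieldType) n (b b' : 'I_n.+1 -> seq 'rV[F]_n.+1) :
  uniq (core_labels b b').
Proof.
have wlabP k c y : y \in wlab b b' k c -> exists i, y = Some (inr (k, c, i)).
  by move=> /mapP[i _ ->]; exists i.
have uw k c : uniq (wlab b b' k c) by rewrite map_inj_uniq ?iota_uniq // => ? ? [].
have urest : uniq (flatten [seq wlab b b' k false ++ wlab b b' k true | k <- index_enum 'I_n.+1]).
  elim: (index_enum _) (index_enum_uniq 'I_n.+1) => //= k r IHr /andP[kr /IHr ur].
  rewrite 2!cat_uniq !uw ur /= !andbT; apply/andP; split.
    by apply/hasPn => y /wlabP[i ->]; apply/negP => /wlabP[].
  apply/hasPn => y /flattenP[_ /mapP[k' k'r ->]] yk'; apply: contra kr => yk.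
  have [c /wlabP[i yE]] : exists c, y \in wlab b b' k c.
    by move: yk; rewrite mem_cat => /orP[]; [exists false|exists true].
  by move: yk'; rewrite yE mem_cat => /orP[] /wlabP[j [->]].
rewrite /core_labels cat_uniq map_inj_uniq ?index_enum_uniq; last by move=> ? ? [].
rewrite /core_rest /= urest andbT negb_or -andbA; apply/and3P; split.
- by apply/mapP => -[].
- apply/hasPn => y /flattenP[_ /mapP[k _ ->]]; rewrite mem_cat.
  by case/orP => /wlabP[i ->]; apply/negP => /mapP[].
- by apply/flattenP => -[_ /mapP[k _ ->]]; rewrite mem_cat => /orP[] /wlabP[].
Qed.

Section LowerBound.
Variables (F : closedFieldType) (n : nat).
Hypothesis charF0 : [pchar F] =i pred0.
Local Notation V := 'rV[F]_n.+1.
Local Notation I := 'I_n.+1.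
Variables (br : V -> V -> V) (S : simple_bracket br).

Section Block.
Variables (b b' : I -> seq V) (q N : nat).
Local Notation K := ('I_q * bool)%type.
Local Notation C := ('I_N.+1 * (K * I))%type.

Definition block_fun (s : 'I_N.+1 -> {perm K * I}) (x : C -> V) : F :=
  \prod_c \det (rows_mx (col_label s c) x).

(** The boolean in [K] groups the columns in pairs, one for each use of [scal_det]. *)
Lemma block_fun_scal s : scal br b b' (index_enum C) (block_fun s).
Proof.
pose u c (c0 : 'I_N.+1 * 'I_q) := col_label s (c0.1, (c0.2, c)).
have := scal_prod (index_enum ('I_N.+1 * 'I_q)%type)
  (fun c0 => scal_det charF0 S (b := b) (b' := b') (u false c0) (u true c0)).
move/(scal_ext (a' := block_fun s)) => H; apply: scal_perm (H _) => [|x]; last first.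
  by rewrite /block_fun big_pair_bool.
apply: perm_trans (col_label_perm s); apply/seq.permP => P.
rewrite !count_flatten !sumnE !big_map big_pair_bool /=.
by apply: eq_bigr => c _; rewrite count_cat.
Qed.

Definition block_point (w : 'I_N.+1 -> {ffun K * I -> I}) (l : C) : V :=
  delta_mx 0 (w l.1 l.2).

Lemma block_fun_point (w : 'I_N.+1 -> {ffun K * I -> I}) (s : 'I_N.+1 -> {perm K * I}) :
  (forall t p, w t (s t p) = p.2) -> block_fun s (block_point w) = 1.
Proof.
move=> ws; apply: big1 => c _.
have -> : rows_mx (col_label s c) (block_point w) = 1%:M; last exact: det1.
by apply/row_matrixP => i; rewrite rowK row1 /block_point /col_label /= ws.
Qed.

(** A letter repeated in a column gives two equal rows, so nonvanishing makes every column
    injective, as [block_words_eq] demands. *)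
Lemma block_fun_point_neq0 (w w' : 'I_N.+1 -> {ffun K * I -> I})
    (s s' : 'I_N.+1 -> {perm K * I}) :
  (forall t p, w t (s t p) = p.2) -> (forall t p, w' t (s' t p) = p.2) ->
  (forall t : 'I_N.+1, (t < n)%N -> w' t = w t) ->
  block_fun s (block_point w') != 0 -> forall t, w' t = w t.
Proof.
move=> ws ws' ww' /prodf_neq0 D0; apply: block_words_eq ws ws' ww' _ => c i j /= ij.
apply/eqP; apply: contraT => neq_ij; move: (D0 c isT).
rewrite (determinant_alternate neq_ij) ?eqxx // => k.
by rewrite !mxE /block_point ij.
Qed.

End Block.

Lemma lie_rank_blocks : exists k0, forall q M,
  lie_rank br ((n + M).+1 * (q * 2 * n.+1) + k0) (#|@balanced ('I_q * bool)%type n| ^ M.+1).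
Proof.
have [b [b' /core_fun_neq0[x0 [_ x0n0]]]] := alternating_words S.
exists (size (core_labels b b')) => q M.
set K := ('I_q * bool)%type; pose N := (n + M)%N.
pose C := ('I_N.+1 * (K * I))%type.
pose W := {w | @balanced K n w}; pose T := {ffun 'I_M.+1 -> W}.
(* The first [n] blocks are frozen, to start the induction of [block_words_eq]; the other [M.+1] are
   free. *)
pose ext (f : T) (t : 'I_N.+1) : {ffun K * I -> I} :=
  if (t < n)%N then [ffun p => p.2] else val (f (inord (t - n))).
have extb f t : balanced (ext f t).
  by rewrite /ext; case: ifP => _; [exact: balanced_snd|exact: valP].
have /choice[s sP] : forall f : T, exists s : 'I_N.+1 -> {perm K * I},
    forall t p, ext f t (s t p) = p.2.
  by move=> f; have [s sP] := choice (fun t => balancedP (extb f t)); exists s.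
have ext_inj f g : (forall t, ext f t = ext g t) -> f = g.
  move=> fg; apply/ffunP => t; apply: val_inj.
  have tN : (n + t < N.+1)%N by rewrite ltnS leq_add2l -ltnS.
  have := fg (Ordinal tN); rewrite /ext /= ltnNge leq_addr /=.
  by rewrite (_ : inord _ = t) //; apply/val_inj; rewrite /= addKn inordK.
pose phi (f : T) := @scal_fun _ _ br b b' _ (block_fun (s f)).
have phi_free : indep_lie br (scal_labels b b' (index_enum C)) phi.
  split=> [f|c c0 f].
    exact/(scal_lie_fun S)/block_fun_scal.
  pose x (y : clabel n + C) := match y with inl y => x0 y | inr l => block_point (ext f) l end.
  have := c0 x; rewrite (bigD1 f) //= big1 => [|g gf].
    rewrite addr0 /phi /scal_fun -[x \o inr]/(block_point (ext f)) -[x \o inl]/x0.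
    rewrite (block_fun_point (sP f)) scale1r => /eqP.
    by rewrite scaler_eq0 (negPf x0n0) orbF => /eqP.
  rewrite /phi /scal_fun -[x \o inr]/(block_point (ext f)).
  suff -> : block_fun (s g) (block_point (ext f)) = 0 by rewrite scale0r scaler0.
  apply/eqP; apply: contraNT gf => g0; apply/eqP/esym/ext_inj => t.
  apply: (block_fun_point_neq0 (sP g) (sP f) _ g0) => t' t'n.
  by rewrite /ext t'n.
have ucore := core_labels_uniq b b'.
have := lie_rankP _ phi_free.
rewrite /scal_labels size_cat !size_map card_ffun card_ord card_sig.
have -> : size (index_enum C) = ((n + M).+1 * (q * 2 * n.+1))%N.
  by rewrite -[index_enum C]enumT -cardT !card_prod !card_ord card_bool.
rewrite -[#|[pred w | balanced w]|]/(#|@balanced K n|); apply.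
rewrite cat_uniq !map_inj_uniq ?index_enum_uniq ?ucore ?andbT /=; try by move=> ? ? [].
by apply/hasPn => y /mapP[z _ ->]; apply/negP => /mapP[].
Qed.

End LowerBound.

(** * Graded codimensions *)

Section QuotDim.
Variables (F : fieldType) (M : lmodType F) (V W : set M).
Hypothesis linW : lin_closed W.

Definition indep_mod r (e : 'I_r -> M) :=
  (forall i, V (e i)) /\ forall c : 'I_r -> F, W (\sum_i c i *: e i) -> forall i, c i = 0.

Lemma indep_mod_leq d r (e : 'I_r -> M) : is_quot_dim V W d -> indep_mod e -> (r <= d)%N.
Proof.
move=> [f [_ _ Vf]] [Ve We].
have /choice[A AP] : forall i, exists c : 'I_d -> F, W (e i - \sum_j c j *: f j).
  by move=> i; exact: Vf.
pose Amx := \matrix_(i, j) A i j.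
rewrite leqNgt; apply/negP => dr.
have /rowV0Pn[u uA un0] : kermx Amx != 0.
  by rewrite kermx_eq0 /row_free neq_ltn (leq_ltn_trans (rank_leq_col _) dr).
move/negP: un0; apply; apply/eqP/rowP => i; rewrite mxE; move: i; apply: (We (u 0)).
have -> : \sum_i u 0 i *: e i = \sum_i u 0 i *: (e i - \sum_j A i j *: f j).
  apply/eqP; rewrite -subr_eq0 -sumrB; apply/eqP.
  under eq_bigr do rewrite -scalerBr opprB addrC subrK scaler_sumr.
  rewrite exchange_big big1 //= => j _; under eq_bigr do rewrite scalerA.
  rewrite -scaler_suml; have /sub_kermxP/rowP/(_ j) := uA; rewrite !mxE => uAj.
  rewrite [X in X *: _](_ : _ = 0) ?scale0r // -[RHS]uAj.
  by apply: eq_bigr => i _; rewrite [Amx _ _]mxE.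
by apply: lin_closed_sum => // i _; apply: lin_closedZ.
Qed.

(** [quot_dim] is chosen by [get], so a finite basis modulo [W] must first be shown to exist: a
    largest independent family, available by the bound, is one. *)
Lemma quot_dimP N : (forall r (e : 'I_r -> M), indep_mod e -> (r <= N)%N) ->
  (quot_dim V W <= N)%N /\
  forall r (e : 'I_r -> M), indep_mod e -> (r <= quot_dim V W)%N.
Proof.
move=> ubN; suff /getPex qd : exists d, is_quot_dim V W d.
  split; last by move=> r e; exact: indep_mod_leq.
  by have [e [Ve We _]] := qd; apply: ubN (e) _.
pose P r := `[< exists e : 'I_r -> M, indep_mod e >].
have exP : exists r, P r.
  exists 0%N; apply/asboolP; exists (fun=> 0); split; last by move=> c _ [].
  by case.
have ubP r : P r -> (r <= N)%N by move=> /asboolP[e]; exact: ubN.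
have [r /asboolP[e [Ve We]] maxr] := ex_maxnP exP ubP.
exists r, e; split => // v Vv; apply: contrapT => nov.
suff /maxr : P r.+1 by rewrite ltnn.
apply/asboolP; exists (fun i => if unlift ord_max i is Some j then e j else v).
split=> [i|c]; first by case: unliftP.
rewrite big_ord_recr /= unlift_none.
under eq_bigr => i _.
  have -> : widen_ord (leqnSn r) i = lift ord_max i.
    by apply: val_inj; rewrite /= /bump leqNgt ltn_ord.
  rewrite liftK; over.
move=> Wc; have c0 : c ord_max = 0.
  apply/eqP; apply: contra_notT nov => c0.
  exists (fun i => - ((c ord_max)^-1 * c (lift ord_max i))).
  have := lin_closedZ linW (c ord_max)^-1 Wc.
  rewrite scalerDr scalerA mulVf // scale1r addrC scaler_sumr -sumrN.
  congr (W (_ + _)); apply: eq_bigr => i _; by rewrite scalerA scaleNr opprK.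
move: Wc; rewrite c0 scale0r addr0 => /We cl i.
by case: (unliftP ord_max i) => [j ->|->]; [exact: cl|].
Qed.

End QuotDim.

Lemma linear_lin_sum (F : fieldType) (U V : lmodType F) (f : U -> V) I (r : seq I)
    (a : I -> F) (u : I -> U) :
  linear f -> f (\sum_(i <- r) a i *: u i) = \sum_(i <- r) a i *: f (u i).
Proof.
move=> linf; have f0 : f 0 = 0.
  by have := linf 1 0 0; rewrite !scale1r addr0 => /(canLR (addrK _)); rewrite subrr.
by elim: r => [|i r IHr]; rewrite ?big_nil // !big_cons linf IHr.
Qed.

Lemma linear_lin_scale (F : fieldType) (U V : lmodType F) (f : U -> V) a u :
  linear f -> f (a *: u) = a *: f u.
Proof.
move=> linf; have := linear_lin_sum [:: tt] (fun=> a) (fun=> u) linf.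
by rewrite !big_seq1.
Qed.

Lemma multilin_lin_closed (F : fieldType) (G : finGroupType) (k : G -> nat) :
  lin_closed (@multilin F G k).
Proof.
split=> [t|a f g mf mg t].
  by rewrite monalg.msupp0 in_fset0.
rewrite -monalg.mcoeff_neq0 monalg.mcoeffD monalg.mcoeffZ => nz.
have [tf|] := boolP (t \in monalg.msupp f); first exact: mf.
move/monalg.mcoeff_outdom => f0; apply: mg.
by move: nz; rewrite f0 mulr0 add0r monalg.mcoeff_neq0.
Qed.

Definition upd (Y : eqType) (T : Type) (u : Y -> T) (y : Y) (v : T) (y' : Y) : T :=
  if y' == y then v else u y'.

Lemma eval_mon_linear (F : fieldType) (Y : choiceType) (L : lmodType F)
    (mul : L -> L -> L) (u : Y -> L) (y : Y) t :
  bilinear_for *:%R *:%R mul -> count_mem y (leaves t) = 1%N ->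
  linear (fun v => eval_mon mul (upd u y v) t).
Proof.
move=> bil yt a v w; case: (bil) => mull mulr.
have noy t' : count_mem y (leaves t') = 0%N -> forall v',
    eval_mon mul (upd u y v') t' = eval_mon mul u t'.
  move=> yt' v'; apply: eq_eval_mon => y' y't'; rewrite /upd; case: eqP => // y'y.
  by move: y't'; rewrite y'y -has_pred1 has_count yt'.
elim: t yt => [y'|t1 IH1 t2 IH2] /=.
  by rewrite /upd addn0; case: eqP.
rewrite count_cat => yt.
case y1 : (count_mem y (leaves t1)) yt IH1 => [|m] yt IH1.
  by rewrite !(noy _ y1) IH2 //; exact: mulr.
move: yt; rewrite addSn => -[/eqP]; rewrite addn_eq0 => /andP[/eqP m0 /eqP y2].
by rewrite !(noy _ y2) IH1 ?m0 //; exact: mull.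
Qed.

Lemma eval_linear_var (F : fieldType) (G : finGroupType) (L : lmodType F)
    (mul : L -> L -> L) (k : G -> nat) f (u : G * nat -> L) y :
  bilinear_for *:%R *:%R mul -> multilin k f -> uniq (gr_vars k) -> y \in gr_vars k ->
  linear (fun v => Defs.eval mul (upd u y v) f).
Proof.
move=> bil mf us ys a v w; rewrite /Defs.eval scaler_sumr -big_split /=.
rewrite big_seq [RHS]big_seq; apply: eq_bigr => t /mf tP.
rewrite eval_mon_linear //.
  by rewrite scalerDr !scalerA mulrC.
by rewrite (seq.permP tP) count_uniq_mem // ys.
Qed.

Lemma gr_vars_uniq (G : finGroupType) (k : G -> nat) : uniq (gr_vars k).
Proof.
apply: allpairs_uniq_dep => [|g _|[g i] [h j] _ _ /= [-> ->] //]; first exact: enum_uniq.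
exact: iota_uniq.
Qed.

Lemma size_gr_vars (G : finGroupType) (k : G -> nat) :
  size (gr_vars k) = (\sum_g k g)%N.
Proof.
rewrite /gr_vars size_allpairs_dep sumnE big_map -[RHS]big_enum /=.
by apply: eq_bigr => g _; rewrite size_iota.
Qed.

Section Codim.
Variables (F : closedFieldType) (G : finGroupType) (B : vectType F).
Variables (br : B -> B -> B) (sigma : G -> G -> F) (n : nat).
Hypothesis bilbr : bilinear_for *:%R *:%R br.
Hypothesis sigma_neq0 : forall g h, sigma g h != 0.
Local Notation mul := (tens_mul sigma br).
Local Notation gr := (@tens_gr F G B).
Local Notation V := 'rV[F]_n.+1.
Hypothesis bilmul : bilinear_for *:%R *:%R mul.
Variables (f : {linear B -> V}) (g : {linear V -> B}).
Hypotheses (fK : cancel f g) (gK : cancel g f) (dimB : dim B = n.+1).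
Variable k : G -> nat.
Local Notation s := (gr_vars k).
Local Notation Y := (G * nat)%type.
Local Notation graded_id := (graded_identity mul gr).

(** The extra index makes [inord] available even for empty [s]; it costs a factor n + 1 in the upper
    bound. *)
Definition basis_point (w : {ffun 'I_(size s).+1 -> 'I_n.+1}) (y : Y) : FGtensor G B :=
  tens y.1 (g (delta_mx 0 (w (inord (index y s))))).

Lemma tens_gr_mem h x : tens h x \in gr h.
Proof. by apply/tens_grP; exists x. Qed.

Lemma graded_id_basis p : multilin k p ->
  (forall w, Defs.eval mul (basis_point w) p = 0) -> graded_id p.
Proof.
move=> mp p0 u ugr.
(* [l] lists the variables whose values are still arbitrary homogeneous elements; those of [s]
   outside [l] already have basis tensors as values. *)
suff H (l : seq Y) : forall u : Y -> FGtensor G B, (forall y, u y \in gr y.1) ->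
    (forall y, y \in s -> y \notin l -> exists j, u y = tens y.1 (g (delta_mx 0 j))) ->
    Defs.eval mul u p = 0.
  by apply: (H s u ugr) => y ->.
elim: l {u ugr} => [|y l IHl] u ugr ubasis.
  have /choice[j jP] : forall y, exists j, y \in s -> u y = tens y.1 (g (delta_mx 0 j)).
    move=> y; have [ys|ys] := boolP (y \in s); last by exists 0.
    by have [j uj] := ubasis y ys isT; exists j.
  rewrite -[RHS](p0 [ffun i : 'I_(size s).+1 => j (nth (1%g, 0%N) s i)]) /Defs.eval.
  rewrite big_seq [RHS]big_seq; apply: eq_bigr => t /mp tP; congr (_ *: _).
  apply: eq_eval_mon => y; rewrite (perm_mem tP) => ys.
  by rewrite /basis_point ffunE inordK ?ltnS ?index_size // nth_index // jP.
have [ys|ys] := boolP (y \in s); last first.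
  apply: IHl => // y' y's y'l; apply: ubasis => //; rewrite inE negb_or y'l andbT.
  by apply: contraNneq ys => <-.
have /tens_grP[x ux] := ugr y.
have uE : u =1 upd u y (\sum_j f x 0 j *: tens y.1 (g (delta_mx 0 j))).
  move=> y'; rewrite /upd; case: eqP => [->|//]; rewrite ux -[x in LHS]fK.
  by rewrite {1}[f x]row_sum_delta !linear_sum; apply: eq_bigr => j _; rewrite !linearZ.
have -> : u = upd u y (\sum_j f x 0 j *: tens y.1 (g (delta_mx 0 j))) by apply/funext.
rewrite (linear_lin_sum _ _ _ (eval_linear_var u bilmul mp (gr_vars_uniq k) ys)).
apply: big1 => j _; rewrite IHl ?scaler0 // => y'.
  by rewrite /upd; case: eqP => [->|//]; exact: tens_gr_mem.
move=> y's y'l; rewrite /upd; case: eqP => [->|/eqP y'y]; first by exists j.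
by apply: ubasis; rewrite // inE negb_or y'y.
Qed.

Lemma graded_id_lin_closed : lin_closed graded_id.
Proof.
split=> [u _|a p q pid qid u ugr]; first exact: linear0.
by rewrite linearP /= pid // qid // scaler0 addr0.
Qed.

Lemma multilin_id_lin_closed : lin_closed (multilin k `&` graded_id)%classic.
Proof.
have [m0 mP] := multilin_lin_closed F k; have [i0 iP] := graded_id_lin_closed.
by split=> // a p q [mp ip] [mq iq]; split; [exact: mP|exact: iP].
Qed.

(** Evaluation at the basis points is injective modulo identities; the bound is the dimension of its
    target. *)
Lemma indep_mod_id_leq r (p : 'I_r -> free_alg F Y) :
  indep_mod (multilin k) (multilin k `&` graded_id)%classic p ->
  (r <= n.+1 ^ (size s).+1 * (#|G| * n.+1))%N.
Proof.
move=> [mp pfree]; pose Om := {ffun 'I_(size s).+1 -> 'I_n.+1}.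
pose Phi q : {ffun Om -> FGtensor G B} := [ffun w => Defs.eval mul (basis_point w) q].
pose A := \matrix_i v2r (Phi (p i)).
have -> : (n.+1 ^ (size s).+1 * (#|G| * n.+1))%N = dim {ffun Om -> FGtensor G B}.
  by rewrite -[RHS]/(#|Om| * (#|G| * dim B))%N dimB card_ffun !card_ord.
rewrite leqNgt; apply/negP => dr.
have /rowV0Pn[c cA cn0] : kermx A != 0.
  by rewrite kermx_eq0 /row_free neq_ltn (leq_ltn_trans (rank_leq_col _) dr).
move/negP: cn0; apply; apply/eqP/rowP => i; rewrite mxE; move: i; apply: (pfree (c 0)).
have mc : multilin k (\sum_i c 0 i *: p i).
  apply: (lin_closed_sum (multilin_lin_closed F k)) => i _.
  exact: (lin_closedZ (multilin_lin_closed F k)).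
split=> //; apply: graded_id_basis => // w.
suff : \sum_i c 0 i *: Phi (p i) = 0.
  move/ffunP/(_ w); rewrite sum_ffunE ffunE linear_sum /=; apply: etrans.
  by apply: eq_bigr => i _; rewrite linearZ !ffunE.
apply: (can_inj v2rK); rewrite linear0 linear_sum.
have /sub_kermxP := cA; rewrite mulmx_sum_row; apply: etrans.
by apply: eq_bigr => i _; rewrite linearZ rowK.
Qed.

Definition coord_br (x y : V) : V := f (br (g x) (g y)).

Lemma eval_mon_coord (Z : choiceType) (x : Z -> V) t :
  eval_mon br (g \o x) t = g (eval_mon coord_br x t).
Proof. by elim: t => //= t1 -> t2 ->; rewrite /coord_br fK. Qed.

(* Evaluating a monomial on homogeneous tensors only changes the underlying value in B
   by a sign. *)
Lemma eval_mon_tens t : exists eps h, eps != 0 /\ forall x : Y -> B,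
  eval_mon mul (fun y => tens y.1 (x y)) t = eps *: tens h (eval_mon br x t).
Proof.
elim: t => [y|t1 [e1 [h1 [n1 E1]]] t2 [e2 [h2 [n2 E2]]]] /=.
  by exists 1, y.1; split; [exact: oner_neq0|move=> x; rewrite scale1r].
exists (e1 * e2 * sigma h1 h2), (h1 * h2)%g; split; first by rewrite !mulf_neq0.
move=> x; rewrite E1 E2; case: (bilmul) => mull mulr.
have /= -> := linear_lin_scale e1 (tens h1 (eval_mon br x t1)) (mull (e2 *: tens h2 _)).
have /= -> := linear_lin_scale e2 (tens h2 (eval_mon br x t2)) (mulr (tens h1 _)).
by rewrite tens_mulE // !scalerA.
Qed.

(** Dividing each coefficient by the scalar [eps] of its monomial compensates the twist by sigma;
    [La], which forgets the degree, then recovers the given functions. *)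
Lemma lie_rank_indep_mod r : lie_rank coord_br (size s) r ->
  exists p : 'I_r -> free_alg F Y,
    indep_mod (multilin k) (multilin k `&` graded_id)%classic p.
Proof.
move=> [phi0 /(indep_lie_rename (1%g, 0%N) (iota_uniq 0 (size s)) (gr_vars_uniq k))].
rewrite size_iota => /(_ erefl); move: (fun _ => _) => phi [phis phi_free].
have /choice[eps epsP] := eval_mon_tens.
have /choice[l lP] := phis.
pose p i := \sum_(q <- l i)
  (q.1 * (eps q.2)^-1) *: (monalg.mkmalgU q.2 1 : free_alg F Y).
have mp i : multilin k (p i).
  rewrite /p big_seq; apply: (lin_closed_sum (multilin_lin_closed F k)) => q ql.
  apply: (lin_closedZ (multilin_lin_closed F k)) => t.
  rewrite monalg.msuppU oner_eq0 in_fset1 => /eqP ->; exact: (lP i).1 ql.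
exists p; split => // c [_ cid] i; apply: phi_free i => x.
pose u y := tens y.1 (g (x y)) : FGtensor G B.
pose La (v : FGtensor G B) : V := f (\sum_h v h).
have linLa : linear La.
  move=> a v w; rewrite /La -linearP scaler_sumr -big_split; congr (f _).
  by apply: eq_bigr => h _; rewrite !ffunE.
have LaE t : La (eval_mon mul u t) = eps t *: eval_mon coord_br x t.
  have [h [_ ->]] := epsP t.
  rewrite (linear_lin_scale _ _ linLa) eval_mon_coord; congr (_ *: _).
  rewrite /La (bigD1 h) //= big1 => [|h' /negPf h'h]; last by rewrite ffunE h'h.
  by rewrite ffunE eqxx addr0 gK.
have := congr1 La (cid u (fun y => tens_gr_mem _ _)).
have -> : La 0 = 0 by rewrite /La big1 ?linear0 // => h _; rewrite ffunE.
apply: etrans; rewrite linear_sum; under [in RHS]eq_bigr do rewrite linearZ /=.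
rewrite (linear_lin_sum _ _ _ linLa); apply: eq_bigr => j _; congr (_ *: _).
rewrite (lP j).2 /p linear_sum; under [in RHS]eq_bigr do rewrite linearZ /=.
rewrite (linear_lin_sum _ _ _ linLa); apply: eq_bigr => q _.
have [h [eps0 _]] := epsP q.2.
by rewrite evalU scale1r LaE scalerA divfK.
Qed.

Lemma quot_dim_bounds r : lie_rank coord_br (size s) r ->
  let d := quot_dim (multilin k) (multilin k `&` graded_id)%classic in
  (r <= d)%N /\ (d <= n.+1 ^ (size s).+1 * (#|G| * n.+1))%N.
Proof.
move=> /lie_rank_indep_mod[p pP] d.
have [ub lb] := quot_dimP multilin_id_lin_closed indep_mod_id_leq.
by split; [exact: lb pP|].
Qed.

End Codim.

Lemma dvdn_prod_fact (T : Type) (r : seq T) (k : T -> nat) :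
  (\prod_(t <- r) (k t)`! %| (\sum_(t <- r) k t)`!)%N.
Proof.
elim: r => [|t r IHr]; first by rewrite !big_nil.
rewrite !big_cons -(bin_fact (leq_addr (\sum_(j <- r) k j) (k t))) addKn.
by rewrite dvdn_mull // dvdn_mul.
Qed.

(* Both sides are n! times the coefficient of 'X^n in the #|T|-th power of the truncated
   exponential series. *)
Lemma sum_multinomial (T : finType) n :
  (\sum_(k : {ffun T -> 'I_n.+1} | \sum_t k t == n) n`! %/ \prod_t (k t)`! = #|T| ^ n)%N.
Proof.
pose E : {poly rat} := \poly_(i < n.+1) (i`!%:R)^-1.
have fact0 i : i`!%:R != 0 :> rat by rewrite pnatr_eq0 -lt0n fact_gt0.
have EX m j : (j <= n)%N -> (E ^+ m)`_j = m%:R ^+ j / j`!%:R.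
  elim: m j => [|m IHm] j jn.
    by rewrite expr0 coef1 expr0n; case: j {jn} => [|j]; rewrite ?mul0r // divr1.
  rewrite exprS coefM -natr1 exprDn mulr_suml; apply: eq_bigr => i _.
  have ij : (i <= j)%N by rewrite -ltnS.
  rewrite coef_poly ltnS (leq_trans ij jn) IHm ?(leq_trans (leq_subr _ _)) //.
  rewrite expr1n mulr1 -(bin_fact ij) -mulr_natl !natrM !invfM mulrA.
  have Cn0 : ('C(j, i))%:R != 0 :> rat by rewrite pnatr_eq0 -lt0n bin_gt0.
  by field; rewrite Cn0 !fact0.
have := EX #|T| n (leqnn n).
have -> : E ^+ #|T| = \sum_(k : {ffun T -> 'I_n.+1})
    (\prod_t ((k t)`!%:R)^-1) *: 'X^(\sum_t k t).
  rewrite -prodr_const /E poly_def bigA_distr_bigA; apply: eq_bigr => k _.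
  by rewrite scaler_prod prodrXr.
rewrite coef_sum => H; apply/eqP; rewrite -(eqr_nat rat); apply/eqP.
move/(congr1 ( *%R n`!%:R)): H; rewrite mulrCA divff // mulr1 natrX => <-.
rewrite natr_sum mulr_sumr big_mkcond; apply: eq_bigr => k _.
rewrite coefZ coefXn [n == _]eq_sym; case: eqP => [kn|_]; last by rewrite mulr0 mulr0.
rewrite mulr1 prodfV -natr_prod; have := dvdn_prod_fact (index_enum T) (fun t => k t).
rewrite kn => /divnK {2}<-; rewrite natrM mulfK //.
by rewrite natr_prod; apply/prodf_neq0 => t _.
Qed.

Lemma coordinates (F : closedFieldType) (B : vectType F) (br : B -> B -> B) :
  is_simple_lie br -> exists n (f : {linear B -> 'rV[F]_n.+1}) (g : {linear 'rV_n.+1 -> B}),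
    [/\ cancel f g, cancel g f, dim B = n.+1 & simple_bracket (coord_br br f g)].
Proof.
move=> [[bil alt jac] nontriv simple].
have [m [f [g [fK gK dimB]]]] : exists m (f : {linear B -> 'rV[F]_m}) (g : {linear 'rV_m -> B}),
    [/\ cancel f g, cancel g f & dim B = m].
  by exists (dim B), v2r, r2v; split; [exact: v2rK|exact: r2vK|].
case: m => [|n] in f g fK gK dimB *.
  have [x [y]] := nontriv; rewrite -[br x y]fK [f _](_ : _ = 0) ?linear0 ?eqxx //.
  by apply/rowP; case.
exists n, f, g; split => //; case: (bil) => bl brr'; split.
- move=> z a x y; rewrite /coord_br linearP; have /= -> := bl (g z) a (g x) (g y).
  by rewrite linearP.
- move=> z a x y; rewrite /coord_br linearP; have /= -> := brr' (g z) a (g x) (g y).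
  by rewrite linearP.
- by move=> x; rewrite /coord_br alt linear0.
- by move=> x y z; rewrite /coord_br !fK -!linearD jac linear0.
- have [x [y xy]] := nontriv; exists (f x), (f y); rewrite /coord_br !fK.
  by rewrite -(inj_eq (can_inj gK)) ?fK ?linear0.
- move=> P linP idP v vn0 Pv w.
  (* [is_simple_lie] speaks of subspaces, so the predicate is replaced by the span of the rows of
     [U]. *)
  have [U UP] := lin_closed_submx linP.
  pose gi i : B := g (row i U); pose I := <<codom gi>>%VS.
  have IP x : x \in I <-> P (f x).
    split=> [xI|/UP/submxP[c cU]].
      have := coord_span (X := in_tuple (codom gi)) xI.
      move=> ->; rewrite linear_sum; apply: (lin_closed_sum linP) => i _.
      rewrite linearZ; apply: (lin_closedZ linP); apply/UP.
      have /codomP[j ->] : (in_tuple (codom gi))`_i \in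
        codom gi by rewrite mem_nth.
      by rewrite /gi gK row_sub.
    rewrite -[x]fK cU mulmx_sum_row linear_sum; apply: memv_suml => i _.
    by rewrite linearZ memvZ // memv_span // (codom_f gi i).
  have /simple[I0|IT] : is_lie_ideal br I.
    move=> x y /IP Py; apply/IP; have := idP (f x) _ Py.
    by rewrite /coord_br !fK.
  + move/negP: vn0; case; rewrite -(inj_eq (can_inj gK)) linear0 -memv0 -I0.
    by apply/IP; rewrite gK.
  + by rewrite -[w]gK; apply/IP; rewrite IT memvf.
Qed.

Section CodimBounds.
Variables (F : closedFieldType) (G : finGroupType) (B : vectType F).
Variables (br : B -> B -> B) (sigma : G -> G -> F) (n : nat).
Hypothesis bilbr : bilinear_for *:%R *:%R br.
Hypothesis sigma_neq0 : forall g h, sigma g h != 0.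
Local Notation mul := (tens_mul sigma br).
Local Notation gr := (@tens_gr F G B).
Hypothesis bilmul : bilinear_for *:%R *:%R mul.
Variables (f : {linear B -> 'rV[F]_n.+1}) (g : {linear 'rV[F]_n.+1 -> B}).
Hypotheses (fK : cancel f g) (gK : cancel g f) (dimB : dim B = n.+1).

(** The bounds depend on the degrees [k] only through their sum, so the multinomial coefficients add
    up to |G|^m. *)
Lemma gr_codim_bounds m r : lie_rank (coord_br br f g) m r ->
  (#|G| ^ m * r <= gr_codim mul gr m)%N /\
  (gr_codim mul gr m <= #|G| ^ m * (n.+1 ^ m.+1 * (#|G| * n.+1)))%N.
Proof.
move=> rk; rewrite -sum_multinomial !big_distrl /gr_codim /=.
have bounds (k : {ffun G -> 'I_m.+1}) : (\sum_h k h == m)%N ->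
    let d := quot_dim (multilin (fun h => k h))
      (multilin (fun h => k h) `&` graded_identity mul gr)%classic in
    (r <= d)%N /\ (d <= n.+1 ^ m.+1 * (#|G| * n.+1))%N.
  move=> /eqP km; have := @quot_dim_bounds _ _ _ br sigma n bilbr sigma_neq0 bilmul f g
    fK gK dimB (fun h => k h) r.
  by rewrite size_gr_vars km; apply.
by split; apply: leq_sum => k /bounds[lb ub]; rewrite leq_mul2l ?lb ?ub orbT.
Qed.

End CodimBounds.

(** * Exponential growth rate *)

Section GrowthRate.
Local Open Scope classical_set_scope.
Variables (R : realType) (a n k0 : nat) (A c : nat -> nat).
Local Notation d := n.+1.
Hypothesis a_gt0 : (0 < a)%N.
Hypothesis A_lower : forall q, exists x,
  (d ^ (q * 2) <= (q * 2).+1 ^ d * x)%N /\ (x ^ d <= A q)%N.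
Hypothesis c_lower : forall q M m,
  ((n + M).+1 * (q * 2 * d) + k0 <= m)%N -> (a ^ m * A q ^ M.+1 <= c m)%N.
Hypothesis c_upper : forall m, (c m <= a ^ m * (d ^ m.+1 * (a * d)))%N.

Local Notation lnn k := (ln (k%:R : R)).

Lemma lnn_leq k l : (0 < k)%N -> (k <= l)%N -> lnn k <= lnn l.
Proof. by move=> k0' kl; rewrite ler_ln ?posrE ?ltr0n ?ler_nat // (leq_trans k0'). Qed.

Lemma lnnM k l : (0 < k)%N -> (0 < l)%N -> lnn (k * l) = lnn k + lnn l.
Proof. by move=> k0' l0; rewrite natrM lnM ?posrE ?ltr0n. Qed.

Lemma lnnX k m : (0 < k)%N -> lnn (k ^ m) = m%:R * lnn k.
Proof. by move=> k0'; rewrite natrX lnXn ?ltr0n // mulr_natl. Qed.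

Lemma lnn_ge0 k : (0 < k)%N -> 0 <= lnn k.
Proof. by move=> k0'; rewrite ln_ge0 // ler1n. Qed.

Lemma A_gt0 q : (0 < A q)%N.
Proof.
have [x [dx xA]] := A_lower q; apply: leq_trans xA; rewrite expn_gt0.
by case: x dx => //; rewrite muln0 leqn0 expn_eq0.
Qed.

Lemma lnA_lower q :
  d%:R * ((q * 2)%:R * lnn d - d%:R * lnn (q * 2).+1) <= lnn (A q).
Proof.
have [x [dx xA]] := A_lower q.
have x_gt0 : (0 < x)%N by case: x dx {xA} => //; rewrite muln0 leqn0 expn_eq0.
apply: le_trans (lnn_leq _ xA); last by rewrite expn_gt0 x_gt0.
rewrite lnnX // ler_wpM2l // lerBlDl -!lnnX // -lnnM ?expn_gt0 //.
by rewrite lnn_leq ?expn_gt0.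
Qed.

(** [t] blocks fit into m variables, n of them frozen. The subtracted term is constant in m, and the
    loss per variable is d ln(2q + 1) / (2q). *)
Lemma lnc_lower q m (L := (q * 2 * d)%N) : (0 < q)%N -> (k0 + d * L <= m)%N ->
  (0 < c m)%N /\
  m%:R * (lnn a + lnn d - d%:R * lnn (q * 2).+1 / (q * 2)%:R)
    - (k0 + d * L)%:R * lnn (A q) / L%:R <= lnn (c m).
Proof.
move=> q_gt0 km; have L_gt0 : (0 < L)%N by rewrite !muln_gt0 q_gt0.
set t := ((m - k0) %/ L)%N.
have dt : (d <= t)%N by rewrite leq_divRL // leq_subRL ?(leq_trans (leq_addr _ _) km).
have tL : (t * L + k0 <= m)%N.
  have := leq_divM (m - k0) L; rewrite -/t => tL.
  by rewrite -(subnK (leq_trans (leq_addr _ _) km)) leq_add2r.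
have := @c_lower q (t - d)%N m; have -> : (n + (t - d)).+1 = t by lia.
move=> /(_ tL) cm; have A0 := A_gt0 q.
have lb_gt0 : (0 < a ^ m * A q ^ (t - d).+1)%N by rewrite muln_gt0 !expn_gt0 a_gt0 A0.
split; first exact: leq_trans cm.
apply: le_trans (lnn_leq lb_gt0 cm); rewrite lnnM ?expn_gt0 ?a_gt0 ?A0 // !lnnX //.
have LR : (0 : R) < L%:R by rewrite ltr0n.
have mM : (m - (k0 + d * L) <= (t - d).+1 * L)%N.
  have := ltn_ceil (m - k0) L_gt0; rewrite -/t.
  have -> : ((t - d).+1 * L = t.+1 * L - d * L)%N by rewrite -mulnBl subSn.
  by move/ltnW => H; rewrite subnDA leq_sub2r.
have mMR : m%:R - (k0 + d * L)%:R <= (t - d).+1%:R * L%:R :> R.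
  by rewrite -natrB // -natrM ler_nat.
rewrite -(ler_pM2l LR) mulrBr [X in _ - X]mulrC divfK ?gt_eqF //.
rewrite mulrCA [in X in _ <= X]mulrDr.
have LE : L%:R * (d%:R * lnn (q * 2).+1 / (q * 2)%:R) = d%:R * (d%:R * lnn (q * 2).+1).
  have q2 : (q * 2)%:R != 0 :> R by rewrite pnatr_eq0 muln_eq0 negb_or -lt0n q_gt0.
  by rewrite /L natrM; move: (lnn _) ((q * 2)%:R : R) q2 => l x x0; field.
have := lnA_lower q; have := lnn_ge0 A0; move: (lnn (A q)) => lA lA0 lAd.
have h1 : (m%:R - (k0 + d * L)%:R) * lA <= (t - d).+1%:R * L%:R * lA by rewrite ler_wpM2r.
have h2 : m%:R * (d%:R * ((q * 2)%:R * lnn d - d%:R * lnn (q * 2).+1)) <= m%:R * lA.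
  by rewrite ler_wpM2l.
have LdE : L%:R = (q * 2)%:R * d%:R :> R by rewrite -natrM.
have -> : m%:R * (L%:R * (lnn a + lnn d - d%:R * lnn (q * 2).+1 / (q * 2)%:R)) =
  m%:R * (L%:R * lnn a) + m%:R * (d%:R * ((q * 2)%:R * lnn d - d%:R * lnn (q * 2).+1)).
  by rewrite mulrBr LE LdE; ring.
rewrite mulrBl in h1; lra.
Qed.

Lemma lnc_cvg : lnn (c m) / m%:R @[m --> \oo] --> lnn (a * d).
Proof.
apply/cvgrPdist_le => eps eps_gt0; rewrite lnnM //.
have ln4 : 0 <= lnn 4 by exact: lnn_ge0.
have [j jP] : exists j : nat, d%:R * lnn 4 / j.+1%:R <= eps / 2%:R.

  exists (Num.bound (d%:R * lnn 4 * 2%:R / eps)).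
  set x := d%:R * lnn 4 * 2%:R / eps.
  have x0 : 0 <= x by rewrite !mulr_ge0 ?invr_ge0 ?ler0n ?(ltW eps_gt0).
  have := archi_boundP x0; rewrite ltr_pdivrMr // => H.
  by rewrite ler_pdivrMr ?ltr0n // -natr1; lra.
(* Now ln(2q + 1) <= (j + 1) ln 4 and (j + 1)^2 <= 2q, so the loss is at most d ln 4 / (j + 1). *)
pose q := (4 ^ j)%N; have q_gt0 : (0 < q)%N by rewrite expn_gt0.
have qP : d%:R * lnn (q * 2).+1 / (q * 2)%:R <= eps / 2%:R.
  apply: le_trans jP; rewrite -!mulrA ler_wpM2l //.
  rewrite ler_pdivrMr ?ltr0n ?muln_gt0 ?q_gt0 // mulrAC ler_pdivlMr ?ltr0n //.
  have : lnn (q * 2).+1 <= j.+1%:R * lnn 4.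
    by rewrite -lnnX // lnn_leq // expnS /q; have := q_gt0; rewrite /q; lia.
  have : (j.+1 * j.+1 <= q * 2)%N.
    rewrite /q; elim: (j) => // i; rewrite expnS; nia.
  rewrite -(ler_nat R) natrM => h1 h2.
  apply: (le_trans (ler_wpM2r _ h2)); first exact: ler0n.
  by rewrite mulrAC mulrC ler_wpM2l.
have [m0 m0P] : exists m0, forall m, (m0 <= m)%N ->
  Num.max (lnn (d * (a * d))) ((k0 + d * (q * 2 * d))%:R * lnn (A q) / (q * 2 * d)%:R) <=
   eps / 2%:R * m%:R.
  set x := Num.max _ _; have x0 : 0 <= x.
    by rewrite /x le_max lnn_ge0 ?orbT // !muln_gt0 a_gt0.
  exists (Num.bound (x * 2%:R / eps)) => m mm.
  have y0 : 0 <= x * 2%:R / eps by rewrite !mulr_ge0 ?invr_ge0 ?ler0n ?(ltW eps_gt0).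
  have := archi_boundP y0; rewrite ltr_pdivrMr // => H.
  have : (Num.bound (x * 2%:R / eps))%:R * eps <= m%:R * eps.
    by rewrite ler_wpM2r ?ler_nat // ltW.
  lra.
near=> m.
have m_gt0 : (0 < m)%N by near: m; exact: nbhs_infty_gt.
have /m0P : (m0 <= m)%N by near: m; exact: nbhs_infty_ge.
rewrite ge_max => /andP[ub lb].
have [|c_gt0 lnc] := @lnc_lower q m q_gt0 _.
  by near: m; exact: nbhs_infty_ge.
have := lnn_leq c_gt0 (c_upper m).
rewrite lnnM ?expn_gt0 ?a_gt0 ?muln_gt0 //; last by rewrite !expn_gt0 a_gt0.
rewrite expnS -mulnA mulnCA lnnM ?expn_gt0 ?muln_gt0 ?a_gt0 //.
rewrite !lnnX // => uc.
have mR : (0 : R) < m%:R by rewrite ltr0n.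
rewrite ler_distlC.
apply/andP; split.
  rewrite ler_pdivlMr //; apply: le_trans lnc.
  have := ler_wpM2l (ltW mR) qP; move: lb.
  by move: (_ / (q * 2 * d)%:R) (_ / (q * 2)%:R) => x y; lra.
have em : 0 <= eps * m%:R by rewrite mulr_ge0 ?ltW.
by rewrite ler_pdivrMr //; move: ub uc; lra.
Unshelve. all: by end_near. Qed.

Lemma root_cvg : (c m)%:R `^ (m%:R)^-1 @[m --> \oo] --> ((a * d)%:R : R).
Proof.
have := cvg_comp _ _ lnc_cvg (@continuous_expR R (lnn (a * d))).
rewrite lnK ?posrE ?ltr0n ?muln_gt0 ?a_gt0 //.
apply: cvg_trans; apply: near_eq_cvg; near=> m.
(* [powR] is the exponential of a logarithm only at a nonzero base; q = 1 is enough for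
   positivity. *)
have [|c_gt0 _] := @lnc_lower 1 m isT _; first by near: m; exact: nbhs_infty_ge.
by rewrite /powR pnatr_eq0 gtn_eqF // mulrC.
Unshelve. all: by end_near. Qed.

End GrowthRate.

Unset Implicit Arguments.
Set Strict Implicit.
Set Printing Implicit Defensive.

Theorem theorem5p3 (R : realType) (F : closedFieldType)
    (charF0 : [pchar F] =i pred0)
    (G : finGroupType) (a b : G)
    (order_a : #[a]%g = 2%N) (order_b : #[b]%g = 2%N)
    (defG : (<[a]> \x <[b]>)%g = [set: G])
    (beta : G -> G -> F) (beta_bichar : is_skew_bicharacter beta)
    (B : vectType F) (br : B -> B -> B) (simpleB : is_simple_lie br)
    (sigma : G -> G -> F)
    (sigma_sign : forall g h, sigma g h = 1 \/ sigma g h = -1)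
    (colorL : is_color_lie_superalgebra
                (tens_mul sigma br) (@tens_gr F G B) beta) :
  [/\ cvgn (gr_codim_root (tens_mul sigma br) (@tens_gr F G B) R),
      PIexp_gr (tens_mul sigma br) (@tens_gr F G B) R
        = (#|G| * \dim (fullv : {vspace B}))%:R,
      (#|G| * \dim (fullv : {vspace B}) = 4 * \dim (fullv : {vspace B}))%N
    & (4 * \dim (fullv : {vspace B})
        = \dim (fullv : {vspace FGtensor G B}))%N].
Proof.
have cardG : #|G| = 4%N.
  by rewrite -cardsT -(dprod_card defG) -!orderE order_a order_b.
have sigma_neq0 g h : sigma g h != 0.
  by case: (sigma_sign g h) => ->; rewrite ?oppr_eq0 oner_neq0.
have bilbr : bilinear_for *:%R *:%R br by case: simpleB => -[].
have bilmul : bilinear_for *:%R *:%R (tens_mul sigma br) by case: colorL => -[].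
have [n [f [g [fK gK dimB S]]]] := coordinates simpleB.
have bounds := gr_codim_bounds bilbr sigma_neq0 bilmul fK gK dimB.
have [k0 k0P] := lie_rank_blocks charF0 S.
(* [bounds] yields the upper bound together with a rank; rank 0 makes it available for every m. *)
have rank0 m : lie_rank (coord_br br f g) m 0.
  by exists (fun _ _ => 0); split=> [[]|c _ []].
have A_lower q := card_balanced ('I_q * bool)%type n.
have root : (gr_codim_root (tens_mul sigma br) (@tens_gr F G B) R @ \oo -->
    ((#|G| * n.+1)%:R : R))%classic.
  apply: (root_cvg (k0 := k0) (A := fun q => #|@balanced ('I_q * bool)%type n|)).
  - by rewrite cardG.
  - by move=> q; have := A_lower q; rewrite card_prod card_ord card_bool.
  - by move=> q M m /(lie_rank_leq S) km; have [] := bounds _ _ (km _ (k0P q M)).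
  - by move=> m; have [] := bounds _ _ (rank0 m).
have dimBn : \dim (fullv : {vspace B}) = n.+1 by rewrite dimvf.
split.
- by apply/cvg_ex; eexists; exact: root.
- by rewrite dimBn; apply/cvg_lim.
- by rewrite cardG.
- by rewrite -cardG !dimvf.
Qed.
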